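(* Let $s\ge 1$ and let $X$ be a finite set of unit vectors in $\mathbb{C}^d$ spanning pairwise distinct lines, and suppose that $0$ is in the degree set of $X$. Then any two of the following conditions imply the third: (a) $X$ is an $s$-distance set; (b) $X$ is a $(2s-1)$-design; (c) $|X|=\dim(\mathrm{Hom}(s,s-1))$.
   Context: The degree set of a set $X$ of unit vectors in $\mathbb{C}^d$ is $A=\{|x^*y|^2: x,y\in X,\ x\neq y\}$; $X$ is an $s$-distance set if $|A|=s$. $\mathrm{Hom}(k,l)$ is the complex vector space of polynomials in $z_1,\dots,z_d,\bar z_1,\dots,\bar z_d$ that are homogeneous of degree $k$ in the $z_i$ and homogeneous of degree $l$ in the $\bar z_i$; its dimension is $\binom{d+k-1}{d-1}\binom{d+l-1}{d-1}$. Let $\Omega$ be the unit sphere in $\mathbb{C}^d$ with the unitarily invariant probability measure $\omega$. A finite set $X\subset\Omega$ is a $t$-design if $\frac1{|X|}\sum_{z\in X}f(z)=\int_\Omega f\,d\omega$ for every $f\in\mathrm{Hom}(t,t)$. *)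

(* Defs.v *)
From HB Require Import structures.
From mathcomp Require Import all_boot all_order all_algebra finmap.
From mathcomp Require Import complex.
From mathcomp Require Import all_classical all_reals all_analysis.
(* The notations of mpoly clash with those of MathComp-Analysis. *)
From mathcomp Require Import -(notations) mpoly.

Set Implicit Arguments.
Unset Strict Implicit.
Unset Printing Implicit Defensive.

Import Order.TTheory GRing.Theory Num.Theory.
Import numFieldNormedType.Exports.

Local Open Scope classical_set_scope.
Local Open Scope fset_scope.
Local Open Scope complex_scope.
Local Open Scope ring_scope.

(* x^* y, conjugate-linear in x. *)
Definition hdot (R : realType) (d : nat) (x y : 'cV[R[i]]_d) : R[i] :=
  \sum_(j < d) Num.conj (x j 0) * y j 0.

Definition sphere (R : realType) (d : nat) : set 'cV[R[i]]_d :=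
  [set z | hdot z z = 1].
Arguments sphere : clear implicits.

Definition distinct_lines (R : realType) (d : nat) (X : {fset 'cV[R[i]]_d}) :
    Prop :=
  forall x y, x \in X -> y \in X -> x != y -> forall c : R[i], y <> c *: x.

Definition degree_set (R : realType) (d : nat) (X : {fset 'cV[R[i]]_d}) :
    {fset R[i]} :=
  [fset `|hdot x y| ^+ 2 | x in X, y in X `\ x].

Definition distance_set (R : realType) (d s : nat) (X : {fset 'cV[R[i]]_d}) :
    Prop :=
  #|` degree_set X| = s.

(* Hom(k,l) inside the formal polynomials in d + d variables: the first d stand
   for z_1, ..., z_d, the last d for their conjugates. *)
Definition homPoly (R : realType) (d k l : nat) : set (mpoly (d + d) R[i]) :=
  [set f | forall m, m \in msupp f ->
     (\sum_(j < d) m (lshift d j) = k)%N /\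
     (\sum_(j < d) m (rshift d j) = l)%N].
Arguments homPoly : clear implicits.

Definition eval_conj (R : realType) (d : nat) (f : mpoly (d + d) R[i])
    (z : 'cV[R[i]]_d) : R[i] :=
  meval (fun j : 'I_(d + d) => match fintype.split j with
                               | inl a => z a 0
                               | inr b => Num.conj (z b 0)
                               end) f.

(* The linear subspace S has a basis with n elements. *)
Definition has_dim (K : fieldType) (V : lmodType K) (S : set V) (n : nat) :
    Prop :=
  exists e : 'I_n -> V, (forall i, S (e i)) /\
    forall v, S v -> exists! c : 'rV[K]_n, v = \sum_(i < n) c 0 i *: e i.

(* C^d with its Borel sigma-algebra; R[i]^o is R[i] seen as a normed module
   over itself, which gives the matrices over it their topology. *)
Definition borelC (R : realType) (d : nat) : Type :=
  g_sigma_algebraType (@open 'cV[R[i]^o]_d).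

(* omega is the unitarily invariant probability measure of the unit sphere,
   seen as a Borel measure on C^d that is concentrated on the sphere. *)
Definition invariant_on_sphere (R : realType) (d : nat)
    (omega : probability (borelC R d) R) : Prop :=
  omega (sphere R d) = 1%E /\
  forall U : 'M[R[i]]_d, U \is unitarymx ->
    forall A : set (borelC R d), measurable A ->
      omega ((fun z : 'cV[R[i]]_d => U *m z) @^-1` A) = omega A.

Definition Cintegral (R : realType) (d : nat)
    (omega : probability (borelC R d) R)
    (D : set (borelC R d)) (f : borelC R d -> R[i]) : R[i] :=
  (\int[omega]_(z in D) complex.Re (f z))
    +i* (\int[omega]_(z in D) complex.Im (f z)).

Definition design (R : realType) (d : nat)
    (omega : probability (borelC R d) R) (t : nat) (X : {fset 'cV[R[i]]_d}) :
    Prop :=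
  forall f : mpoly (d + d) R[i], homPoly R d t t f ->
    (#|` X|%:R)^-1 * (\sum_(z <- X) eval_conj f z)
      = Cintegral omega (sphere R d) (eval_conj f).

(* Main.v *)
Require Import Defs.
From mathcomp Require Import all_boot all_order all_algebra finmap.
From mathcomp Require Import complex.
From mathcomp Require Import all_classical all_reals all_analysis.
From mathcomp Require Import -(notations) mpoly.
From mathcomp Require Import measurable_realfun.
From mathcomp Require Import ring zify.

Set Implicit Arguments.
Unset Strict Implicit.
Unset Printing Implicit Defensive.

Import Order.TTheory GRing.Theory Num.Theory.
Import numFieldNormedType.Exports.

Local Open Scope classical_set_scope.
Local Open Scope complex_scope.
Local Open Scope ring_scope.

(* Write [V] for Hom(s, s - 1), [n] for [|X|], and [F_x] in [V] for the
   annihilator polynomial of the degree set centred at [x].  When [X] is an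
   [s]-distance set, [F_x(y)] is a nonzero constant [D] times the Kronecker delta
   on [X], so the [F_x] are independent.  When [X] is a [(2s - 1)]-design, an [f]
   in [V] vanishing on [X] has mean square zero, hence is zero, so evaluation on
   [X] is injective on [V].  Together these make the [F_x] a basis of [V].

   If the [F_x] are a basis, then [D F_z = \sum_x conj (F_x z) F_x] for every unit
   vector [z].  Let [G] be their Gram matrix for the invariant measure.  By
   transitivity of the unitary group the mean square of [F_z] is a constant [g],
   and integrating the mean square of both sides over [z] gives
   [\sum_(x, y) |G x y|^2 = D^2 g = n g^2 = \sum_x |G x x|^2].  So [G] is scalar:
   [X] integrates the products [f conj h], [f] and [h] in [V], which span
   Hom(2s - 1, 2s - 1).

   If [X] is a design and evaluation on [X] is bijective on [V], the Lagrange
   functions are multiples of reproducing kernels, hence equivariant.  Averaging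
   over rotations turns the Lagrange function at [x] into a polynomial of degree
   at most [s - 1] that vanishes at [1 / t - 1] for every nonzero degree [t]. *)

(** * Hermitian products and unitary maps *)

Section HermitianProduct.
Variables (R : realType) (d : nat).
Implicit Types (x y z u v w : 'cV[R[i]]_d) (U : 'M[R[i]]_d).

Lemma hdotE x y : hdot x y = ((x^t*)%sesqui *m y) 0 0.
Proof. by rewrite mxE; apply: eq_bigr => j _; rewrite !mxE. Qed.

Lemma hdotDr x y z : hdot x (y + z) = hdot x y + hdot x z.
Proof. by rewrite !hdotE mulmxDr mxE. Qed.

Lemma hdotZr c x y : hdot x (c *: y) = c * hdot x y.
Proof. by rewrite !hdotE -scalemxAr mxE. Qed.

Lemma hdotBr x y z : hdot x (y - z) = hdot x y - hdot x z.
Proof. by rewrite -scaleN1r hdotDr hdotZr mulN1r. Qed.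

Lemma conj_hdot x y : Num.conj (hdot x y) = hdot y x.
Proof.
rewrite /hdot rmorph_sum; apply: eq_bigr => j _.
by rewrite rmorphM /= conjCK mulrC.
Qed.

Lemma hdotDl x y z : hdot (x + y) z = hdot x z + hdot y z.
Proof. by rewrite -conj_hdot hdotDr rmorphD /= !conj_hdot. Qed.

Lemma hdotZl c x y : hdot (c *: x) y = Num.conj c * hdot x y.
Proof. by rewrite -conj_hdot hdotZr rmorphM /= conj_hdot. Qed.

Lemma hdotBl x y z : hdot (x - y) z = hdot x z - hdot y z.
Proof. by rewrite -conj_hdot hdotBr rmorphB /= !conj_hdot. Qed.

Lemma hdot_sqr x y : hdot x y * hdot y x = `|hdot x y| ^+ 2.
Proof. by rewrite normCK conj_hdot. Qed.

Lemma hdot_coord z j : `|z j 0| ^+ 2 <= hdot z z.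
Proof.
rewrite /hdot (bigD1 j) //= mulrC -normCK lerDl.
by apply: sumr_ge0 => i _; rewrite mulrC -normCK exprn_ge0.
Qed.

Lemma hdot_ge0 z : 0 <= hdot z z.
Proof. by apply: sumr_ge0 => i _; rewrite mulrC -normCK exprn_ge0. Qed.

Lemma hdot_eq0 z : hdot z z = 0 -> z = 0.
Proof.
move=> z0; apply/matrixP => i j; rewrite ord1 mxE.
have := hdot_coord z i; rewrite z0 => le0.
by apply/eqP; rewrite -normr_eq0 -sqrf_eq0 eq_le le0 exprn_ge0.
Qed.

Lemma hdot_unitary U x y : U \is unitarymx -> hdot (U *m x) (U *m y) = hdot x y.
Proof.
move=> Uu; rewrite !hdotE trmx_mul map_mxM /= mulmxA mulmxKtV //.
Qed.

Lemma sphere_unitary U x : U \is unitarymx ->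
  sphere R d x -> sphere R d (U *m x).
Proof. by move=> Uu; rewrite /sphere /= hdot_unitary. Qed.

(** Strict Cauchy-Schwarz: the residual of [y] after projection onto [x] has squared norm
    [1 - |hdot x y|^2], and noncollinearity makes it nonzero. *)
Lemma hdot_noncollinear x y : sphere R d x -> sphere R d y ->
  (forall c, y <> c *: x) -> `|hdot x y| ^+ 2 < 1.
Proof.
rewrite /sphere /= => hx hy ncol; pose a := hdot x y.
have E : hdot (y - a *: x) (y - a *: x) = 1 - `|a| ^+ 2.
  rewrite hdotBr !hdotBl !hdotZr !hdotZl hx hy -/a -(conj_hdot x y) -/a normCK.
  by ring.
rewrite -subr_gt0 -E lt_neqAle hdot_ge0 andbT eq_sym; apply/eqP => /hdot_eq0 h.
by apply: (ncol a); apply/eqP; rewrite -subr_eq0 h.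
Qed.

(** Testing on pairs of standard basis vectors gives [U^* U = 1]; [mulmx1C] turns this into
    [U U^* = 1]. *)
Lemma unitarymx_isometry U : (forall x y, hdot (U *m x) (U *m y) = hdot x y) ->
  U \is unitarymx.
Proof.
move=> iso; apply/unitarymxP/mulmx1C; apply/matrixP => i j.
have := iso (delta_mx i 0) (delta_mx j 0).
rewrite -!colE /hdot.
under eq_bigr do rewrite !mxE.
under [RHS]eq_bigr do rewrite !mxE !andbT.
rewrite [X in _ = X](bigD1 i) //= eqxx conjC1 mul1r [X in _ + X]big1 ?addr0; last first.
  by move=> k /negPf ->; rewrite conjC0 mul0r.
by move=> E; rewrite !mxE -E; apply: eq_bigr => k _; rewrite !mxE.
Qed.

(* The complex Householder map [I - w w^* / (w^* u)] with [w = u - v]; it is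
   unitary because [1/b + 1/conj b = |w|^2 / |b|^2] for [b = w^* u]. *)
Lemma unitary_move u v : sphere R d u -> sphere R d v ->
  exists2 U, U \is unitarymx & U *m u = v /\
    forall x, hdot (u - v) x = 0 -> U *m x = x.
Proof.
rewrite /sphere /= => hu hv; pose w := u - v; pose b := hdot w u.
(* Since [w^* u = 1 - v^* u], the case [b = 0] forces [v^* u = 1], hence [w = 0], and the identity
   map serves. *)
have [b0|bn0] := eqVneq b 0.
  have w0 : w = 0.
    apply: hdot_eq0; rewrite /w hdotBr -/w -/b b0 sub0r.
    rewrite -(conj_hdot v w) /w hdotBr hv.
    move: b0; rewrite /b /w hdotBl hu => /eqP; rewrite subr_eq0 => /eqP <-.
    by rewrite subrr conjC0 oppr0.
  exists 1%:M.
    by apply: unitarymx_isometry => x y; rewrite !mul1mx.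
  by rewrite mul1mx; split=> [|x _]; rewrite ?mul1mx //; apply/subr0_eq.
pose U := 1%:M - b^-1 *: (w *m (w^t*)%sesqui).
have UE x : U *m x = x - (b^-1 * hdot w x) *: w.
  rewrite /U mulmxBl mul1mx -scalemxAl -mulmxA; congr (_ - _).
  by rewrite [_ *m x]mx11_scalar -hdotE mul_mx_scalar scalerA.
have bb : b + Num.conj b = hdot w w.
  by rewrite /b conj_hdot /w !(hdotBl, hdotBr) hu hv; ring.
have wE : w = u - v by [].
have wu : hdot w u = b by [].
clearbody b U w; exists U.
  apply: unitarymx_isometry => x y; rewrite !UE hdotBr !hdotBl !hdotZr !hdotZl.
  rewrite -bb rmorphM /= fmorphV /= conj_hdot.
  have cb0 : Num.conj b != 0 by rewrite conjC_eq0.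
  by field; rewrite bn0 cb0.
split; first by rewrite UE wu mulVf // scale1r wE opprB addrC subrK.
by rewrite -wE => x wx; rewrite UE wx mulr0 scale0r subr0.
Qed.

(** After moving [x] to [x0], move [U1 y] to [y0] along [U1 y - y0]. Both vectors have the same
    product with [x0], so that difference is orthogonal to [x0] and the second map fixes it. *)
Lemma unitary_move2 x y x0 y0 :
  sphere R d x -> sphere R d y -> sphere R d x0 -> sphere R d y0 ->
  hdot x y = hdot x0 y0 ->
  exists2 U, U \is unitarymx & U *m x = x0 /\ U *m y = y0.
Proof.
move=> sx sy sx0 sy0 xy; have [U1 U1u [U1x _]] := unitary_move sx sx0.
have [U2 U2u [U2y U2f]] := unitary_move (sphere_unitary U1u sy) sy0.
exists (U2 *m U1); first exact: mul_unitarymx.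
rewrite -!mulmxA U1x U2y; split=> //; apply: U2f.
have E : hdot (U1 *m y) (U1 *m x) = hdot y0 x0.
  by rewrite (hdot_unitary y x U1u) -(conj_hdot x y) xy conj_hdot.
by rewrite hdotBl -E U1x; exact: subrr.
Qed.
End HermitianProduct.

(** Indexing by ordinals lets functions on a finite set be treated as rows and matrices. *)
Lemma fset_enumeration (T : choiceType) (X : {fset T}) (x0 : T) :
  exists xs : 'I_#|` X|%fset -> T,
    [/\ injective xs, forall i, xs i \in X & forall y, y \in X -> exists i, y = xs i].
Proof.
exists (fun i => nth x0 X i); split=> [i j /eqP|i|y yX].
- by rewrite nth_uniq ?fset_uniq // => /eqP /val_inj.
- exact: mem_nth.
have yn : (index y X < #|` X|%fset)%N by rewrite index_mem.
by exists (Ordinal yn); rewrite /= nth_index.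
Qed.

(** * Bihomogeneous functions *)

Lemma base_expansion_inj (n K : nat) (a b : 'I_n -> nat) :
  (forall i, a i < K)%N -> (forall i, b i < K)%N ->
  (\sum_(i < n) a i * K ^ i = \sum_(i < n) b i * K ^ i)%N -> a =1 b.
Proof.
elim: n a b => [|n IHn] a b aK bK; first by move=> _ [].
rewrite !big_ord_recl !expn0 !muln1.
under eq_bigr do rewrite lift0 expnS mulnCA.
under [in RHS]eq_bigr do rewrite lift0 expnS mulnCA.
rewrite -!big_distrr /= => E.
have K0 : (0 < K)%N by apply: leq_ltn_trans (aK ord0).
have E0 : a ord0 = b ord0.
  have := congr1 (modn^~ K) E.
  by rewrite ![(_ + K * _)%N]addnC ![(K * _)%N]mulnC !modnMDl !modn_small.
move: E; rewrite E0 => /addnI /eqP; rewrite eqn_pmul2l // => /eqP E.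
have {IHn} IH := IHn _ _ (fun i => aK (lift ord0 i)) (fun i => bK (lift ord0 i)) E.
move=> i; case: (unliftP ord0 i) => [j ->|-> //]; exact: IH.
Qed.

(* Kronecker substitution: [v i = t ^ (K ^ i)] separates the monomials whose
   exponents are all below [K]. *)
Lemma mpoly_vanish_nat (F : numFieldType) (n : nat) (p : mpoly n F) :
  (forall v : 'I_n -> nat, meval (fun i => (v i)%:R) p = 0) -> p = 0.
Proof.
move=> p0; pose K := mmeasure mdeg p.
have mK (m : multinom n) i : m \in msupp p -> (m i < K)%N.
  move=> mp; apply: leq_ltn_trans (msize_mdeg_lt mp).
  by rewrite mdegE (bigD1 i) //= leq_addr.
pose e (m : multinom n) := (\sum_(i < n) m i * K ^ i)%N.
pose q : {poly F} := \sum_(m <- msupp p) mcoeff m p *: 'X^(e m).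
have q0 : q = 0.
  apply/eqP; apply: contraT => qn0.
  (* [q] takes at [t] the value of [p] at the point [t ^ (K ^ i)], so every natural number is a
     root, and [size q] roots are too many. *)
  pose s : seq F := [seq k%:R | k <- iota 0 (size q)].
  have := @max_poly_roots _ q s qn0.
  rewrite size_map size_iota ltnn; apply; last first.
    by rewrite map_inj_uniq ?iota_uniq // => x y /eqP; rewrite eqr_nat => /eqP.
  apply/allP => _ /mapP [t _ ->]; rewrite /root /q horner_sum.
  apply/eqP; rewrite -[RHS](p0 (fun i => t ^ K ^ i)%N) mevalE.
  apply: eq_bigr => m _; rewrite hornerZ hornerXn; congr (_ * _).
  rewrite /e -natrX expn_sum natr_prod; apply: eq_bigr => i _.
  by rewrite -natrX -expnM mulnC.
apply/mpolyP => m; rewrite mcoeff0.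
have [mp|/memN_msupp_eq0 //] := boolP (m \in msupp p).
have : q`_(e m) = 0 by rewrite q0 coef0.
rewrite /q coef_sum (bigD1_seq m) ?msupp_uniq //=.
rewrite coefZ coefXn eqxx mulr1 big_seq_cond big1 ?addr0 // => m' /andP [m'p m'm].
rewrite coefZ coefXn; case: eqP => [em|_]; last by rewrite mulr0.
case/eqP: m'm; apply/mnmP => i; symmetry.
by apply: (base_expansion_inj _ _ em) => k; exact: mK.
Qed.

Lemma split_lshiftE m n (a : 'I_m) : fintype.split (lshift n a) = inl a.
Proof. exact: (unsplitK (inl a)). Qed.

Lemma split_rshiftE m n (a : 'I_n) : fintype.split (rshift m a) = inr a.
Proof. exact: (unsplitK (inr a)). Qed.

(* The substitution [z = a + i b], [conj z = a - i b] is invertible on formal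
   polynomials, and [a], [b] may be taken to be natural numbers. *)
Lemma eval_conj_inj (R : realType) (d : nat) (p : mpoly (d + d) R[i]) :
  (forall z : 'cV[R[i]]_d, eval_conj p z = 0) -> p = 0.
Proof.
move=> p0; pose X j : mpoly (d + d) R[i] := mpolyX R[i] (mnm1 j).
pose lq := [tuple match fintype.split j with
  | inl a => X (lshift d a) + 'i *: X (rshift d a)
  | inr a => X (lshift d a) - 'i *: X (rshift d a) end | j < d + d].
pose q := comp_mpoly lq p.
have qE v : meval v q = meval (fun j => match fintype.split j with
  | inl a => v (lshift d a) + 'i * v (rshift d a)
  | inr a => v (lshift d a) - 'i * v (rshift d a) end) p.
  rewrite comp_mpoly_meval; apply: meval_eq => j; rewrite tnth_mktuple.
  case: (split_ordP j) => a _.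
    by rewrite mevalD mevalZ !mevalXU.
  by rewrite mevalB mevalZ !mevalXU.
have q0 : q = 0.
  apply: mpoly_vanish_nat => v; rewrite qE.
  rewrite -[RHS](p0 (\col_a ((v (lshift d a))%:R + 'i * (v (rshift d a))%:R))).
  apply: meval_eq => j; case: (split_ordP j) => a _.
    by rewrite mxE.
  rewrite mxE.
  by rewrite rmorphD rmorphM /= !conjC_nat conjCi mulNr.
apply: mpoly_vanish_nat => v; pose w j : R[i] := (v j)%:R.
(* The inverse substitution, [a = (z + conj z) / 2] and [b = (z - conj z) / (2 i)]: it recovers the
   value of [p] at [w] from [q]. *)
pose u (j : 'I_(d + d)) : R[i] := match fintype.split j with
  | inl a => (w (lshift d a) + w (rshift d a)) / 2%:R
  | inr a => (w (lshift d a) - w (rshift d a)) / (2%:R * 'i) end.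
have := qE u; rewrite q0 meval0 => ->; apply: meval_eq => j.
have i0 : 'i != 0 :> R[i] by exact: neq0Ci.
rewrite -/(w j) /u; case: (split_ordP j) => a ->.
  by rewrite !split_lshiftE split_rshiftE; field; exact: i0.
by rewrite split_lshiftE !split_rshiftE; field; exact: i0.
Qed.

Section Bihomogeneous.
Variables (R : realType) (d : nat).
Local Notation C := R[i].
Local Notation V := 'cV[C]_d.
Implicit Types (f g : V -> C).

(** Hom(k, l) as a space of functions, closed under pointwise operations; by [eval_conj_inj] the
    representing polynomial is unique. *)
Definition bihom (k l : nat) (f : V -> C) :=
  exists2 p, homPoly R d k l p & forall z, eval_conj p z = f z.

Lemma eq_bihom k l f g : f =1 g -> bihom k l f -> bihom k l g.
Proof. by move=> fg [p hp E]; exists p => // z; rewrite E fg. Qed.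

Lemma bihomD k l f g : bihom k l f -> bihom k l g ->
  bihom k l (fun z => f z + g z).
Proof.
move=> [p hp Ep] [q hq Eq]; exists (p + q) => [m|z].
  by move/msuppD_le; rewrite mem_cat => /orP [/hp|/hq].
by rewrite /eval_conj mevalD -Ep -Eq.
Qed.

Lemma bihomZ k l c f : bihom k l f -> bihom k l (fun z => c * f z).
Proof.
move=> [p hp Ep]; exists (c *: p) => [m /msuppZ_le/hp //|z].
by rewrite /eval_conj mevalZ -Ep.
Qed.

Lemma bihom0 k l : bihom k l (fun=> 0).
Proof. by exists 0 => [m|z]; rewrite ?msupp0 // /eval_conj meval0. Qed.

Lemma bihomB k l f g : bihom k l f -> bihom k l g ->
  bihom k l (fun z => f z - g z).
Proof.
move=> hf /(bihomZ (-1)) hg; apply: eq_bihom (bihomD hf hg) => z.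
by rewrite mulN1r.
Qed.

Lemma bihom_sum k l (I : Type) (r : seq I) (P : pred I) (F : I -> V -> C) :
  (forall i, P i -> bihom k l (F i)) ->
  bihom k l (fun z => \sum_(i <- r | P i) F i z).
Proof.
move=> hF; elim: r => [|i r IHr].
  by apply: eq_bihom (bihom0 k l) => z; rewrite big_nil.
case Pi: (P i); last by apply: eq_bihom IHr => z; rewrite big_cons Pi.
apply: eq_bihom (bihomD (hF i Pi) IHr) => z.
by rewrite big_cons Pi.
Qed.

Lemma bihomM k l k' l' f g : bihom k l f -> bihom k' l' g ->
  bihom (k + k') (l + l') (fun z => f z * g z).
Proof.
move=> [p hp Ep] [q hq Eq]; exists (p * q) => [m|z].
  move=> /msuppM_le /allpairsP [[m1 m2] /= [/hp [a1 b1] /hq [a2 b2] ->]].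
  by split; rewrite -?a1 -?a2 -?b1 -?b2 -big_split;
    apply: eq_bigr => j _; rewrite mnmDE.
by rewrite /eval_conj mevalM -Ep -Eq.
Qed.

Lemma bihom1 : bihom 0 0 (fun=> 1).
Proof.
exists 1 => [m|z]; last by rewrite /eval_conj meval1.
by rewrite msupp1 inE => /eqP ->; split; apply: big1 => j _; rewrite mnm0E.
Qed.

Lemma bihomX k l f n : bihom k l f -> bihom (k * n) (l * n) (fun z => f z ^+ n).
Proof.
move=> hf; elim: n => [|n IHn].
  by rewrite !muln0; apply: eq_bihom bihom1 => z; rewrite expr0.
by rewrite !mulnS; apply: eq_bihom (bihomM hf IHn) => z; rewrite exprS.
Qed.

Lemma bihom_prod (I : Type) (r : seq I) (k l : I -> nat) (F : I -> V -> C) :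
  (forall i, bihom (k i) (l i) (F i)) ->
  bihom (\sum_(i <- r) k i)%N (\sum_(i <- r) l i)%N
    (fun z => \prod_(i <- r) F i z).
Proof.
move=> hF; elim: r => [|i r IHr].
  by rewrite !big_nil; apply: eq_bihom bihom1 => z; rewrite big_nil.
by rewrite !big_cons; apply: eq_bihom (bihomM (hF i) IHr) => z; rewrite big_cons.
Qed.

Lemma bihom_coord j : bihom 1 0 (fun z => z j 0).
Proof.
exists (mpolyX C (mnm1 (lshift d j))) => [m|z].
  rewrite msuppX inE => /eqP ->; split.
    rewrite (bigD1 j) //= mnm1E eqxx big1 // => i ij.
    by rewrite mnm1E (inj_eq (@lshift_inj _ _)) eq_sym (negPf ij).
  by apply: big1 => i _; rewrite mnm1E eq_lrshift.
by rewrite /eval_conj mevalXU split_lshiftE.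
Qed.

Lemma bihom_conj_coord j : bihom 0 1 (fun z => Num.conj (z j 0)).
Proof.
exists (mpolyX C (mnm1 (rshift d j))) => [m|z].
  rewrite msuppX inE => /eqP ->; split.
    by apply: big1 => i _; rewrite mnm1E eq_rlshift.
  rewrite (bigD1 j) //= mnm1E eqxx big1 // => i ij.
  by rewrite mnm1E (inj_eq (@rshift_inj _ _)) eq_sym (negPf ij).
by rewrite /eval_conj mevalXU split_rshiftE.
Qed.

Lemma bihomE k l f : bihom k l f -> exists p : mpoly (d + d) C,
  (forall m, m \in msupp p -> (\sum_(j < d) m (lshift d j) = k)%N /\
     (\sum_(j < d) m (rshift d j) = l)%N) /\
  forall z, f z = \sum_(m <- msupp p) mcoeff m p *
    ((\prod_(j < d) z j 0 ^+ m (lshift d j)) *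
     (\prod_(j < d) Num.conj (z j 0) ^+ m (rshift d j))).
Proof.
move=> [p hp Ep]; exists p; split=> // z; rewrite -Ep /eval_conj mevalE.
apply: eq_bigr => m _; congr (_ * _); rewrite big_split_ord /=.
congr (_ * _); apply: eq_bigr => j _.
  by rewrite split_lshiftE.
by rewrite split_rshiftE.
Qed.

(** Monomials factor into a part in [z] and a part in [conj z], so substitution, conjugation,
    scaling and the design identity can each be checked on these factors. *)
Lemma bihom_ind (P : (V -> C) -> Prop) k l :
  (forall f g, f =1 g -> P f -> P g) -> P (fun=> 0) ->
  (forall f g, P f -> P g -> P (fun z => f z + g z)) ->
  (forall (c : C) (a b : 'I_d -> nat),
    (\sum_j a j = k)%N -> (\sum_j b j = l)%N ->
    P (fun z => c * ((\prod_(j < d) z j 0 ^+ a j) *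
                     (\prod_(j < d) Num.conj (z j 0) ^+ b j)))) ->
  forall f, bihom k l f -> P f.
Proof.
move=> Peq P0 PD Pm f /bihomE [p [hp Ef]].
apply: (Peq _ _ (fun z => esym (Ef z))).
(* Only the left-hand list is generalized: the induction runs over its tails, while [hp] needs
   membership in the whole support. *)
have : {subset msupp p <= msupp p} by [].
elim: {1 3}(msupp p) => [_|m r IHr rp].
  by apply: (Peq (fun=> 0)) => // z; rewrite big_nil.
have [am bm] := hp _ (rp m (mem_head _ _)).
apply: Peq (PD _ _ (Pm (mcoeff m p) _ _ am bm) (IHr _)) => [z|m' m'r].
  by rewrite big_cons.
by apply: rp; rewrite inE m'r orbT.
Qed.

Lemma bihom_subst k l f (F : V -> V) : bihom k l f ->
  (forall j, bihom 1 0 (fun z => F z j 0)) ->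
  (forall j, bihom 0 1 (fun z => Num.conj (F z j 0))) ->
  bihom k l (f \o F).
Proof.
move=> hf hF hcF; move: hf; apply: (@bihom_ind (fun f => bihom k l (f \o F))).
- by move=> f1 f2 E; apply: eq_bihom => z /=.
- exact: bihom0.
- by move=> f1 f2; exact: bihomD.
move=> c a b ak bl; apply: bihomZ.
have := bihomM
  (bihom_prod (index_enum 'I_d) (fun j => bihomX (a j) (hF j)))
  (bihom_prod (index_enum 'I_d) (fun j => bihomX (b j) (hcF j))).
by under eq_bigr do rewrite mul1n;
  under [X in bihom (_ + X)]eq_bigr do rewrite mul0n;
  under [X in bihom _ (X + _)]eq_bigr do rewrite mul0n;
  under [X in bihom _ (_ + X)]eq_bigr do rewrite mul1n;
  rewrite ak bl !big1 // addn0 add0n.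
Qed.

Lemma bihom_conj k l f : bihom k l f -> bihom l k (fun z => Num.conj (f z)).
Proof.
apply: (@bihom_ind (fun f => bihom l k (fun z => Num.conj (f z)))).
- by move=> f1 f2 E; apply: eq_bihom => z; rewrite E.
- by apply: eq_bihom (bihom0 l k) => z; rewrite conjC0.
- by move=> f1 f2 h1 h2; apply: eq_bihom (bihomD h1 h2) => z; rewrite rmorphD.
move=> c a b ak bl.
have := bihomM
  (bihom_prod (index_enum 'I_d) (fun j => bihomX (b j) (bihom_coord j)))
  (bihom_prod (index_enum 'I_d) (fun j => bihomX (a j) (bihom_conj_coord j))).
under eq_bigr do rewrite mul1n;
  under [X in bihom (_ + X)]eq_bigr do rewrite mul0n;
  under [X in bihom _ (X + _)]eq_bigr do rewrite mul0n;
  under [X in bihom _ (_ + X)]eq_bigr do rewrite mul1n;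
  rewrite ak bl !big1 // addn0 add0n => /(bihomZ (Num.conj c)).
apply: eq_bihom => z; rewrite !rmorphM /= !rmorph_prod /=; congr (_ * _).
rewrite mulrC; congr (_ * _); apply: eq_bigr => j _; rewrite rmorphXn //=.
by rewrite conjCK.
Qed.

Lemma bihom_hdotr x : bihom 1 0 (hdot x).
Proof. by apply: bihom_sum => j _; apply/bihomZ/bihom_coord. Qed.

Lemma bihom_hdotl x : bihom 0 1 (fun z => hdot z x).
Proof.
apply: bihom_sum => j _; apply: eq_bihom (bihomZ (x j 0) (bihom_conj_coord j)).
by move=> z; rewrite mulrC.
Qed.

Lemma bihom_normsq : bihom 1 1 (fun z => hdot z z).
Proof.
apply: bihom_sum => j _.
exact: bihomM (bihom_conj_coord j) (bihom_coord j).
Qed.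

Lemma bihom_mulmx k l f (U : 'M[C]_d) : bihom k l f ->
  bihom k l (fun z => f (U *m z)).
Proof.
move=> hf; apply: (bihom_subst hf) => j.
  apply: (@eq_bihom _ _ (fun z => \sum_i U j i * z i 0)) => [z|]; rewrite ?mxE //.
  by apply: bihom_sum => i _; apply/bihomZ/bihom_coord.
apply: (@eq_bihom _ _ (fun z => \sum_i Num.conj (U j i) * Num.conj (z i 0))).
  by move=> z; rewrite mxE rmorph_sum; apply: eq_bigr => i _; rewrite rmorphM.
by apply: bihom_sum => i _; apply/bihomZ/bihom_conj_coord.
Qed.

(** Formal polynomials form an integral domain, and by [eval_conj_inj] a nonzero one is nonzero at
    some point. The two given points may differ. *)
Lemma bihom_mul_neq0 k l k' l' f g : bihom k l f -> bihom k' l' g ->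
  (exists z, f z != 0) -> (exists z, g z != 0) -> exists z, f z * g z != 0.
Proof.
move=> [p _ Ep] [q _ Eq] [zf fz] [zg gz].
have p0 : p != 0.
  by apply: contra_neq fz => p0; rewrite -Ep p0 /eval_conj meval0.
have q0 : q != 0.
  by apply: contra_neq gz => q0; rewrite -Eq q0 /eval_conj meval0.
apply: contrapT => h; have /eqP := mulf_neq0 p0 q0; apply.
apply: eval_conj_inj => z; rewrite /eval_conj mevalM.
rewrite -/(eval_conj p z) -/(eval_conj q z) Ep Eq.
by apply/eqP; apply: contrapT => /negP hz; apply: h; exists z.
Qed.

Lemma bihom_scale k l (f : V -> C) c z : bihom k l f ->
  f (c *: z) = c ^+ k * Num.conj c ^+ l * f z.
Proof.
apply: (@bihom_ind (fun f => f (c *: z) = c ^+ k * Num.conj c ^+ l * f z)).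
- by move=> f1 f2 E; rewrite !E.
- by rewrite mulr0.
- by move=> f1 f2 -> ->; rewrite mulrDr.
move=> e a b <- <-.
have -> : \prod_(j < d) (c *: z) j 0 ^+ a j =
    c ^+ (\sum_j a j) * \prod_(j < d) z j 0 ^+ a j.
  rewrite -prodrXr -big_split; apply: eq_bigr => j _.
  by rewrite mxE exprMn.
have -> : \prod_(j < d) Num.conj ((c *: z) j 0) ^+ b j =
    Num.conj c ^+ (\sum_j b j) * \prod_(j < d) Num.conj (z j 0) ^+ b j.
  rewrite -prodrXr -big_split; apply: eq_bigr => j _.
  by rewrite mxE rmorphM exprMn.
ring.
Qed.
End Bihomogeneous.

(** * Integration over the sphere *)

Section SphereIntegral.
Variables (R : realType) (d : nat).
Local Notation C := R[i].
Local Notation V := 'cV[C]_d.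
Local Notation S := (sphere R d : set (borelC R d)).
Implicit Types (f g : V -> C).

(** * Borel measurability of coordinates and of continuous functions *)

Lemma continuous_lipschitz1 (h : R[i] -> R) :
  (forall z w, `|h z - h w|%:C <= `|z - w|) -> continuous (h : R[i]^o -> R).
Proof.
move=> hh z A /nbhs_ballP [e /= e0 HA]; apply/nbhs_ballP.
exists e%:C => /=; first by rewrite ltcR.
move=> w; rewrite -ball_normE /= => zw; apply: HA; rewrite -ball_normE /= -ltcR.
exact: le_lt_trans zw.
Qed.

Lemma Re_continuous : continuous (@complex.Re R : R[i]^o -> R).
Proof.
by apply: continuous_lipschitz1 => z w; rewrite -raddfB; exact: normc_ge_Re.
Qed.

Lemma normc_ge_Im (z : R[i]) : `|complex.Im z|%:C <= `|z|.
Proof.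
rewrite -normrN -ReiNIm; apply: le_trans (normc_ge_Re _) _.
by rewrite normrM normc_def [X in _ * X]normc_def /= expr0n expr1n add0r sqrtr1 mulr1.
Qed.

Lemma Im_continuous : continuous (@complex.Im R : R[i]^o -> R).
Proof.
by apply: continuous_lipschitz1 => z w; rewrite -raddfB; exact: normc_ge_Im.
Qed.

Lemma measurable_continuous (h : V -> R) :
  continuous (h : 'cV[R[i]^o]_d -> R) ->
  measurable_fun setT (h : borelC R d -> R).
Proof.
move=> ch; apply: (measurability (@RGenOpens.G R)).
  exact: RGenOpens.measurableE.
move=> _ [_ [a [b ->]] <-]; rewrite setTI; apply: sub_sigma_algebra.
by apply: open_comp => [z _|]; [exact: ch|exact: interval_open].
Qed.

Lemma measurable_Re_coord j :
  measurable_fun setT (fun z : borelC R d => complex.Re ((z : V) j 0)).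
Proof.
apply: measurable_continuous => z.
apply: (@continuous_comp _ _ _ (fun z : 'cV[R[i]^o]_d => z j 0 : R[i]^o)).
  exact: coord_continuous.
exact: Re_continuous.
Qed.

Lemma measurable_Im_coord j :
  measurable_fun setT (fun z : borelC R d => complex.Im ((z : V) j 0)).
Proof.
apply: measurable_continuous => z.
apply: (@continuous_comp _ _ _ (fun z : 'cV[R[i]^o]_d => z j 0 : R[i]^o)).
  exact: coord_continuous.
exact: Im_continuous.
Qed.
(** A class closed under sums, products and conjugation, all of whose members are integrable on the
    sphere because the sphere has finite measure. *)
Definition regular f :=
  [/\ measurable_fun setT (fun z : borelC R d => complex.Re (f z)),
      measurable_fun setT (fun z : borelC R d => complex.Im (f z)) &
      exists M : R, forall z, sphere R d z -> `|f z| <= M%:C].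

Lemma eq_regular f g : f =1 g -> regular f -> regular g.
Proof. by move=> /funext ->. Qed.

Lemma regular_cst (c : C) : regular (fun=> c).
Proof.
split; [exact: measurable_cst|exact: measurable_cst|].
exists (complex.Re `|c|) => z _; rewrite RRe_real //; exact: normr_real.
Qed.

Lemma regularD f g : regular f -> regular g -> regular (fun z => f z + g z).
Proof.
move=> [fr fi [M fM]] [gr gi [N gN]]; split.
- apply: eq_measurable_fun (measurable_funD fr gr) => z _ /=.
  by rewrite raddfD.
- apply: eq_measurable_fun (measurable_funD fi gi) => z _ /=.
  by rewrite raddfD.
exists (M + N) => z Sz; apply: le_trans (ler_normD _ _) _.
by rewrite rmorphD /= lerD ?fM ?gN.
Qed.

Lemma Re_mul (x y : C) : complex.Re (x * y) =
  complex.Re x * complex.Re y - complex.Im x * complex.Im y.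
Proof. by case: x y => [a b] [c e]. Qed.

Lemma Im_mul (x y : C) : complex.Im (x * y) =
  complex.Re x * complex.Im y + complex.Im x * complex.Re y.
Proof. by case: x y => [a b] [c e]. Qed.

Lemma regularM f g : regular f -> regular g -> regular (fun z => f z * g z).
Proof.
move=> [fr fi [M fM]] [gr gi [N gN]]; split.
- apply: eq_measurable_fun (measurable_funB (measurable_funM fr gr)
    (measurable_funM fi gi)) => z _ /=.
  by rewrite Re_mul.
- apply: eq_measurable_fun (measurable_funD (measurable_funM fr gi)
    (measurable_funM fi gr)) => z _ /=.
  by rewrite Im_mul.
exists (M * N) => z Sz; rewrite normrM rmorphM /= ler_pM //; [exact: fM|exact: gN].
Qed.

Lemma regular_conj f : regular f -> regular (fun z => Num.conj (f z)).
Proof.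
move=> [fr fi [M fM]]; split.
- by apply: eq_measurable_fun fr => z _ /=; case: (f z).
- apply: eq_measurable_fun (measurable_funN fi) => z _ /=.
  by case: (f z).
by exists M => z Sz; rewrite norm_conjC fM.
Qed.

Lemma regularZ c f : regular f -> regular (fun z => c * f z).
Proof. exact: regularM (regular_cst c). Qed.

Lemma regular_sum (I : Type) (r : seq I) (F : I -> V -> C) :
  (forall i, regular (F i)) -> regular (fun z => \sum_(i <- r) F i z).
Proof.
move=> hF; elim: r => [|i r IHr].
  by apply: eq_regular (regular_cst 0) => z; rewrite big_nil.
by apply: eq_regular (regularD (hF i) IHr) => z; rewrite big_cons.
Qed.

Lemma regular_coord j : regular (fun z => z j 0).
Proof.
split; [exact: measurable_Re_coord|exact: measurable_Im_coord|].
exists 1 => z Sz; rewrite -(@expr_le1 _ 2) //.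
by have := hdot_coord z j; rewrite Sz.
Qed.

Lemma regularX f n : regular f -> regular (fun z => f z ^+ n).
Proof.
move=> hf; elim: n => [|n IHn].
  by apply: eq_regular (regular_cst 1) => z; rewrite expr0.
by apply: eq_regular (regularM hf IHn) => z; rewrite exprS.
Qed.

Lemma regular_prod (I : Type) (r : seq I) (F : I -> V -> C) :
  (forall i, regular (F i)) -> regular (fun z => \prod_(i <- r) F i z).
Proof.
move=> hF; elim: r => [|i r IHr].
  by apply: eq_regular (regular_cst 1) => z; rewrite big_nil.
by apply: eq_regular (regularM (hF i) IHr) => z; rewrite big_cons.
Qed.

Lemma regular_eval_conj p : regular (@eval_conj R d p).
Proof.
apply: (@eq_regular (fun z => \sum_(m <- msupp p) mcoeff m p *
  \prod_i (match fintype.split i with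
           | inl a => z a 0 | inr b => Num.conj (z b 0) end) ^+ m i)).
  by move=> z; rewrite /eval_conj mevalE.
apply: regular_sum => m; apply/regularZ/regular_prod => i; apply: regularX.
by case: fintype.split => a; [|apply: regular_conj]; exact: regular_coord.
Qed.

Lemma regular_bihom k l f : bihom k l f -> regular f.
Proof. by move=> [p _ /eq_regular]; apply; exact: regular_eval_conj. Qed.

Lemma measurable_sphere : measurable S.
Proof.
have [mr mi _] := regular_bihom (bihom_normsq R d).
have -> : S = (fun z : borelC R d => complex.Re (hdot z z)) @^-1` [set 1]%classic `&`
    (fun z : borelC R d => complex.Im (hdot z z)) @^-1` [set 0].
  apply/seteqP; split=> z; rewrite /sphere /=; first by move=> ->.
  by case: (hdot z z) => a b /= [-> ->].
by apply: measurableI; rewrite -[X in measurable X]setTI; [apply: mr|apply: mi];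
  rewrite //; exact: measurable_set1.
Qed.

(** Neighbourhoods of a matrix are entrywise and there are finitely many entries, so continuity of
    each entry, a finite sum of products, suffices. *)
Lemma continuous_mulmx (U : 'M[C]_d) :
  continuous ((fun z => U *m z) : 'cV[R[i]^o]_d -> 'cV[R[i]^o]_d).
Proof.
move=> z A [P Pz PA].
have cs i j (r : seq 'I_d) : continuous
    ((fun z => \sum_(k <- r) U i k * z k j) : 'cV[R[i]^o]_d -> R[i]^o).
  elim: r => [|k r IHr].
    rewrite (_ : (fun _ => _) = fun=> 0); first exact: cst_continuous.
    by apply/funext => v; rewrite big_nil.
  rewrite (_ : (fun _ => _) = (fun z : 'cV[R[i]^o]_d => U i k * z k j : R[i]^o) \+
      (fun z => \sum_(k <- r) U i k * z k j)); last first.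
    by apply/funext => v; rewrite big_cons.
  move=> w; apply: continuousD; last exact: IHr.
  apply: (@continuousM _ _ (fun=> U i k) (fun z : 'cV[R[i]^o]_d => z k j)).
    exact: cst_continuous.
  exact: coord_continuous.
have ce i j : continuous ((fun z => (U *m z) i j) : 'cV[R[i]^o]_d -> R[i]^o).
  rewrite (_ : (fun _ => _) = (fun z : 'cV[R[i]^o]_d => \sum_k U i k * z k j)).
    exact: cs.
  by apply/funext => v; rewrite mxE.
have : \forall w \near z, forall ij : 'I_d * 'I_1, P ij.1 ij.2 ((U *m w) ij.1 ij.2).
  apply: (filter_forall (nbhs_filter (z : 'cV[R[i]^o]_d))) => -[i j].
  exact: (ce i j z _ (Pz i j)).
apply: (filterS (Filter := nbhs_filter (z : 'cV[R[i]^o]_d))) => w hw.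
by apply: PA => i j; exact: (hw (i, j)).
Qed.

Lemma measurable_mulmx (U : 'M[C]_d) :
  measurable_fun setT (fun z : borelC R d => (U *m (z : V)) : borelC R d).
Proof.
apply: (@measurability _ _ _ (borelC R d) _ _ (@open 'cV[R[i]^o]_d)) => //.
move=> _ [A oA <-]; rewrite setTI; apply: sub_sigma_algebra.
by apply: open_comp oA => z _; exact: continuous_mulmx.
Qed.

(** * Linearity, positivity and unitary invariance of the integral *)

Variables (omega : probability (borelC R d) R).
Hypothesis homega : invariant_on_sphere omega.
Local Notation L f := (Cintegral omega S f).

Lemma eq_Cintegral f g : (forall z, sphere R d z -> f z = g z) -> L f = L g.
Proof.
move=> fg; rewrite /Cintegral; congr (_ +i* _); apply: eq_Rintegral => z.
  by rewrite inE => /fg ->.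
by rewrite inE => /fg ->.
Qed.

Lemma sphere_lty : (omega S < +oo)%E.
Proof. by have [-> _] := homega; rewrite ltry. Qed.

Lemma regular_integrable (h : borelC R d -> R) (M : R) :
  measurable_fun setT h -> (forall z, S z -> `|h z| <= M) ->
  omega.-integrable S (EFin \o h).
Proof.
move=> mh hM; apply: measurable_bounded_integrable.
- exact: measurable_sphere.
- exact: sphere_lty.
- exact: measurable_funTS.
exists M; split; first exact: num_real.
by move=> N MN z Sz /=; apply: le_trans (hM z Sz) (ltW MN).
Qed.

Lemma regular_Re f : regular f ->
  omega.-integrable S (EFin \o (fun z : borelC R d => complex.Re (f z))).
Proof.
move=> [fr _ [M fM]]; apply: (regular_integrable fr (M := M)) => z Sz.
by rewrite -lecR; apply: le_trans (fM z Sz); exact: normc_ge_Re.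
Qed.

Lemma regular_Im f : regular f ->
  omega.-integrable S (EFin \o (fun z : borelC R d => complex.Im (f z))).
Proof.
move=> [_ fi [M fM]]; apply: (regular_integrable fi (M := M)) => z Sz.
by rewrite -lecR; apply: le_trans (fM z Sz); exact: normc_ge_Im.
Qed.

Lemma CintegralD f g : regular f -> regular g ->
  L (fun z => f z + g z) = L f + L g.
Proof.
move=> rf rg; rewrite /Cintegral /=.
under eq_Rintegral do rewrite raddfD.
under [X in _ +i* X]eq_Rintegral do rewrite raddfD.
by rewrite !RintegralD //; [exact: measurable_sphere|exact: regular_Im|
  exact: regular_Im|exact: measurable_sphere|exact: regular_Re|exact: regular_Re].
Qed.

Lemma Cintegral_cst f c : (forall z, sphere R d z -> f z = c) -> L f = c.
Proof.
move=> /eq_Cintegral ->; have [S1 _] := homega; have mS := measurable_sphere.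
have cE a : \int[omega]_(z in S) a = a.
  by rewrite (Rintegral_cst omega mS a) [X in fine X](_ : _ = 1%E) ?mulr1.
by rewrite /Cintegral /= !cE; case: c.
Qed.

Lemma CintegralZ c f : regular f -> L (fun z => c * f z) = c * L f.
Proof.
move=> rf; have mS := measurable_sphere.
have rr := regular_Re rf; have ri := regular_Im rf.
have rrZ a : omega.-integrable S
    (EFin \o (fun z : borelC R d => a * complex.Re (f z))).
  by apply: eq_integrable (integrableZl mS a rr) => // z _; rewrite /= EFinM.
have riZ a : omega.-integrable S
    (EFin \o (fun z : borelC R d => a * complex.Im (f z))).
  by apply: eq_integrable (integrableZl mS a ri) => // z _; rewrite /= EFinM.
rewrite /Cintegral /=.
under eq_Rintegral do rewrite Re_mul.
under [X in _ +i* X]eq_Rintegral do rewrite Im_mul.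
rewrite RintegralB // RintegralD // !RintegralZl //.
by case: c => a b.
Qed.

Lemma Cintegral_sum (I : Type) (r : seq I) (F : I -> V -> C) :
  (forall i, regular (F i)) ->
  L (fun z => \sum_(i <- r) F i z) = \sum_(i <- r) L (F i).
Proof.
move=> rF; elim: r => [|i r IHr].
  by rewrite big_nil; apply: Cintegral_cst => z _; rewrite big_nil.
rewrite big_cons -IHr -CintegralD //; last exact: regular_sum.
by apply: eq_Cintegral => z _; rewrite big_cons.
Qed.

Lemma Cintegral_conj f : regular f ->
  L (fun z => Num.conj (f z)) = Num.conj (L f).
Proof.
move=> rf; rewrite /Cintegral [RHS]/=; congr (_ +i* _).
  by apply: eq_Rintegral => z _; case: (f z).
rewrite -mulN1r -RintegralZl //; [|exact: measurable_sphere|exact: regular_Im].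
by apply: eq_Rintegral => z _; rewrite mulN1r; case: (f z).
Qed.

Lemma Cintegral_ge0 f : (forall z, sphere R d z -> 0 <= f z) -> 0 <= L f.
Proof.
move=> f0; rewrite lecE /=; apply/andP; split.
  rewrite (_ : \int[omega]_(z in S) _ = \int[omega]_(z in S) 0).
    by rewrite Rintegral_cst ?mul0r //; exact: measurable_sphere.
  by apply: eq_Rintegral => z; rewrite inE => /f0 /ger0_Im.
by apply: Rintegral_ge0 => z /f0; rewrite lecE => /andP [].
Qed.

(** If [f] were positive on the whole sphere, a zero integral would put the sphere inside a null
    set, although it has measure 1. *)
Lemma Cintegral_eq0 f : regular f -> (forall z, sphere R d z -> 0 <= f z) ->
  L f = 0 -> exists2 z, sphere R d z & f z = 0.
Proof.
move=> rf f0 Lf0; apply: contrapT => nz.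
have fpos z : S z -> 0 < complex.Re (f z).
  move=> Sz; have : 0 < f z.
    rewrite lt_neqAle eq_sym f0 // andbT; apply/eqP => fz; apply: nz; by exists z.
  by rewrite ltcE => /andP [].
have [S1 _] := homega; have mS := measurable_sphere.
have ri := regular_Re rf; have mf := measurable_int _ ri.
have Re0 : \int[omega]_(z in S) complex.Re (f z) = 0.
  by move: Lf0; rewrite /Cintegral => -[].
have : (\int[omega]_(z in S) `|(complex.Re (f z))%:E|)%E = 0%E.
  rewrite (eq_integral (fun z : borelC R d => (complex.Re (f z))%:E)); last first.
    by move=> z; rewrite inE => Sz; rewrite /= ger0_norm //; exact/ltW/fpos.
  by rewrite -(fineK (integrable_fin_num mS ri)) -[fine _]/(Rintegral _ _ _) Re0.
move/(ae_eq_integral_abs omega mS mf) => [N [mN N0 SN]].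
have SN' : S `<=` N.
  move=> z Sz; apply: SN => /= /(_ Sz) [] E.
  by have := fpos z Sz; rewrite E ltxx.
have : (omega S <= omega N)%E by apply: le_measure; rewrite ?inE.
by rewrite [X in (X <= _)%E]S1 [X in (_ <= X)%E]N0 lee_fin ler10.
Qed.

(** Change of variables: the pushforward of [omega] along [U] agrees with [omega] on measurable
    sets, and [S] is its own preimage. *)
Lemma Rintegral_unitary (U : 'M[C]_d) (h : borelC R d -> R) :
  U \is unitarymx -> measurable_fun setT h ->
  omega.-integrable S (EFin \o (fun z : borelC R d => h (U *m (z : V)))) ->
  \int[omega]_(z in S) h (U *m (z : V)) = \int[omega]_(z in S) h z.
Proof.
move=> Uu mh ih; have [S1 inv] := homega; have mS := measurable_sphere.
have mU := measurable_mulmx U.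
have SU : (fun z : borelC R d => (U *m (z : V)) : borelC R d) @^-1` S = S.
  by apply/seteqP; split=> z; rewrite /sphere /= hdot_unitary.
rewrite /Rintegral; congr fine.
have mh' : measurable_fun setT (EFin \o h) by apply/measurable_EFinP.
have := @integral_pushforward _ _ _ _ _ _ mU omega S (EFin \o h) mh'.
rewrite SU => /(_ ih mS) <-.
by apply: eq_measure_integral => A mA _; exact: (inv U Uu A mA).
Qed.

Lemma Cintegral_unitary (U : 'M[C]_d) f : U \is unitarymx -> regular f ->
  regular (fun z => f (U *m z)) -> L (fun z => f (U *m z)) = L f.
Proof.
move=> Uu rf rfU; have [mr mi _] := rf.
rewrite /Cintegral (Rintegral_unitary Uu mr (regular_Re rfU)).
by rewrite (Rintegral_unitary Uu mi (regular_Im rfU)).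
Qed.

(** * Definiteness of the mean square on bihomogeneous functions *)

Lemma Cintegral_orthogonal f g : regular f -> regular g ->
  L (fun z => f z * Num.conj (f z)) = 0 -> L (fun z => f z * Num.conj (g z)) = 0.
Proof.
move=> rf rg ff0; set q := L (fun z => f z * Num.conj (g z)).
set p := L (fun z => g z * Num.conj (g z)).
have rff := regularM rf (regular_conj rf).
have rfg := regularM rf (regular_conj rg).
have rgf := regularM rg (regular_conj rf).
have rgg := regularM rg (regular_conj rg).
have p0 : 0 <= p by apply: Cintegral_ge0 => z _; rewrite -normCK exprn_ge0.
have qc : L (fun z => g z * Num.conj (f z)) = Num.conj q.
  rewrite -Cintegral_conj //; apply: eq_Cintegral => z _.
  by rewrite rmorphM /= conjCK mulrC.
have [//|qn0] := eqVneq q 0.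
have main t : 0 <= t * q + Num.conj (t * q) + p.
  have -> : t * q + Num.conj (t * q) + p =
      L (fun z => (t * f z + g z) * Num.conj (t * f z + g z)).
    rewrite (@eq_Cintegral _ (fun z => t * Num.conj t * (f z * Num.conj (f z)) +
      (t * (f z * Num.conj (g z)) + (Num.conj t * (g z * Num.conj (f z)) +
      g z * Num.conj (g z))))); last first.
      by move=> z _; rewrite rmorphD rmorphM /=; ring.
    have r1 := regularZ (t * Num.conj t) rff.
    have r2 := regularZ t rfg; have r3 := regularZ (Num.conj t) rgf.
    have r34 := regularD r3 rgg; have r234 := regularD r2 r34.
    rewrite (CintegralD r1 r234) (CintegralD r2 r34) (CintegralD r3 rgg).
    rewrite (CintegralZ _ rff) (CintegralZ _ rfg) (CintegralZ _ rgf) ff0 qc.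
    by rewrite -/q -/p rmorphM /=; ring.
  by apply: Cintegral_ge0 => z _; rewrite -normCK exprn_ge0.
have q2 : 0 < q * Num.conj q by rewrite -normCK exprn_gt0 // normr_gt0.
(* As [f] has mean square zero, the mean square of [t f + g] has no quadratic term in [t]. This [t]
   makes [t q = - (p + 1)], so the nonnegative total would be [- p - 2]. *)
have := main (- ((p + 1) / (q * Num.conj q)) * Num.conj q).
have cp : Num.conj p = p by apply/CrealP/ger0_real.
have -> : - ((p + 1) / (q * Num.conj q)) * Num.conj q * q = - (p + 1).
  by rewrite -mulrA mulNr [Num.conj q * q]mulrC divfK // gt_eqF.
rewrite rmorphN rmorphD /= cp conjC1 => h.
have : - (p + 1) + - (p + 1) + p < 0.
  rewrite -oppr_gt0; have -> : - (- (p + 1) + - (p + 1) + p) = p + 2%:R by ring.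
  by rewrite ltr_wpDl.
by move/(le_lt_trans h); rewrite ltxx.
Qed.

(* The coefficient vectors of mean square zero form the left kernel of the Gram
   matrix, and the mean square of finitely many of them vanishes somewhere. *)
Lemma common_zero (n : nat) (m : 'I_n -> V -> C) : (forall i, regular (m i)) ->
  exists2 z0, sphere R d z0 & forall c : 'rV[C]_n,
    L (fun z => (\sum_i c 0 i * m i z) * Num.conj (\sum_i c 0 i * m i z)) = 0 ->
    \sum_i c 0 i * m i z0 = 0.
Proof.
move=> rm; pose G : 'M[C]_n := \matrix_(i, j) L (fun z => m i z * Num.conj (m j z)).
pose W := kermx G; pose w r z := \sum_i W r i * m i z.
have rcomb (c : 'I_n -> C) : regular (fun z => \sum_i c i * m i z).
  by apply: regular_sum => i; apply/regularZ/rm.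
have GE (c : 'I_n -> C) j : L (fun z => (\sum_i c i * m i z) * Num.conj (m j z)) =
    \sum_i c i * G i j.
  rewrite (@eq_Cintegral _
    (fun z => \sum_i c i * (m i z * Num.conj (m j z)))); last first.
    by move=> z _; rewrite mulr_suml; apply: eq_bigr => i _; rewrite mulrA.
  rewrite Cintegral_sum => [|i]; last first.
    by apply/regularZ/regularM => //; exact: regular_conj.
  apply: eq_bigr => i _; rewrite CintegralZ ?mxE //.
  by apply: regularM => //; exact: regular_conj.
have rw r : regular (fun z => w r z * Num.conj (w r z)).
  by apply: regularM; [exact: rcomb|apply: regular_conj; exact: rcomb].
have ww r : L (fun z => w r z * Num.conj (w r z)) = 0.
  rewrite (@eq_Cintegral _ (fun z => \sum_j Num.conj (W r j) *
      (w r z * Num.conj (m j z)))); last first.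
    move=> z _; rewrite {2}/w rmorph_sum mulr_sumr; apply: eq_bigr => j _.
    by rewrite rmorphM /= mulrCA.
  rewrite Cintegral_sum => [|j]; last first.
    apply/regularZ/regularM; [exact: rcomb|exact: regular_conj].
  apply: big1 => j _; rewrite CintegralZ; last first.
    by apply: regularM; [exact: rcomb|exact: regular_conj].
  rewrite GE; have -> : \sum_i W r i * G i j = (W *m G) r j by rewrite mxE.
  have -> : (W *m G) r j = 0 by rewrite mulmx_ker mxE.
  exact: mulr0.
have w0 r z : 0 <= w r z * Num.conj (w r z) by rewrite -normCK exprn_ge0.
have [z0 Sz0 Fz0] : exists2 z, sphere R d z & \sum_r w r z * Num.conj (w r z) = 0.
  apply: Cintegral_eq0; first exact: regular_sum.
    by move=> z _; apply: sumr_ge0 => r _.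
  by rewrite Cintegral_sum // big1.
have wz0 r : w r z0 = 0.
  have /eqP := Fz0; rewrite psumr_eq0 // => /allP /(_ r (mem_index_enum _)) /eqP.
  by move/eqP; rewrite mulf_eq0 conjC_eq0 orbb => /eqP.
exists z0 => // c c0.
(* Mean square zero gives orthogonality to every [m j] by [Cintegral_orthogonal], so [c] is a
   combination of the rows of [W], whose functions all vanish at [z0]. *)
have /sub_kermxP /submxP [D cD] : c *m G = 0.
  apply/rowP => j; rewrite mxE [RHS]mxE -GE.
  by apply: Cintegral_orthogonal c0.
transitivity (\sum_r D 0 r * w r z0); last first.
  by apply: big1 => r _; rewrite wz0 mulr0.
have cE i : c 0 i = \sum_r D 0 r * W r i by rewrite cD mxE.
under eq_bigr do rewrite cE mulr_suml.
rewrite exchange_big; apply: eq_bigr => r _; rewrite /w mulr_sumr.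
by apply: eq_bigr => i _; rewrite mulrA.
Qed.

Lemma sphere_transitive z0 z : sphere R d z0 -> sphere R d z ->
  exists2 U : 'M[C]_d, U \is unitarymx & U *m z0 = z.
Proof.
by move=> Sz0 Sz; have [U Uu [Uz _]] := unitary_move Sz0 Sz; exists U.
Qed.

Lemma hdot_sphere_scale z : z != 0 ->
  exists2 c : C, c != 0 & sphere R d (c *: z).
Proof.
move=> zn0; have zz0 : 0 < hdot z z.
  rewrite lt_neqAle hdot_ge0 andbT eq_sym.
  by apply: contra_neq zn0; exact: hdot_eq0.
exists (sqrtC (hdot z z))^-1; first by rewrite invr_eq0 sqrtC_eq0 gt_eqF.
rewrite /sphere /= hdotZl hdotZr.
have -> : Num.conj (sqrtC (hdot z z))^-1 = (sqrtC (hdot z z))^-1.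
  by apply/CrealP/ger0_real; rewrite invr_ge0 sqrtC_ge0 ltW.
by rewrite mulrA -expr2 exprVn sqrtCK mulVf // gt_eqF.
Qed.

Lemma bihom_sphere_eq0 k l f : bihom k l f ->
  (forall z, sphere R d z -> f z = 0) -> (exists z, sphere R d z) ->
  forall z, f z = 0.
Proof.
move=> bf fS [z0 Sz0] z; have [->|zn0] := eqVneq z 0.
  (* For [k = l = 0] the scaling factor is 1 even at [c = 0], so the value at the origin is read off
     from a point of the sphere. *)
  by rewrite -(scale0r z0) (bihom_scale _ _ bf) fS // mulr0.
have [c cn0 /fS] := hdot_sphere_scale zn0.
rewrite (bihom_scale _ _ bf) => /eqP; rewrite !mulf_eq0 !expf_eq0 conjC_eq0.
by rewrite (negPf cn0) !andbF => /eqP.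
Qed.

(* [f] composed with any unitary map has mean square zero too, so all these
   functions vanish at one common point, whose orbit is the whole sphere. *)
Lemma bihom_definite k l f : bihom k l f ->
  L (fun z => f z * Num.conj (f z)) = 0 -> forall z, f z = 0.
Proof.
(* The monomials of degree below [K] form one finite family whose span contains the composites of
   [f] with all unitary maps, as [common_zero] requires. *)
move=> bf Lf; pose K := (k + l).+1.
pose n := #|{: bmultinom (d + d) K}|.
pose m (i : 'I_n) := @eval_conj R d (mpolyX C (bmnm (enum_val i))).
have [z0 Sz0 hz0] := common_zero (fun i : 'I_n => regular_eval_conj _ : regular (m i)).
apply: (bihom_sphere_eq0 bf); last by exists z0.
move=> z Sz; have [U Uu <-] := sphere_transitive Sz0 Sz.
have bfU := bihom_mulmx U bf.
have [p hp Ep] := bfU.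
have pK : (mmeasure mdeg p <= K)%N.
  rewrite mmeasureE; apply/bigmax_leqP_seq => mm /hp [ak bl] _.
  have E : mdeg mm = (k + l)%N by rewrite mdegE big_split_ord /= ak bl.
  by rewrite ltnS; exact: eq_leq E.
have pE w : f (U *m w) =
    \sum_i (\row_(i < n) mcoeff (bmnm (enum_val i)) p) 0 i * m i w.
  rewrite -Ep [in LHS](mpolywE pK) /eval_conj raddf_sum /=.
  rewrite (eq_bigl (mem {: bmultinom (d + d) K})) // big_enum_val.
  by apply: eq_bigr => i _; rewrite mevalZ mxE.
rewrite pE; apply: hz0.
rewrite -[RHS]Lf; have rf := regular_bihom bf; have rfU := regular_bihom bfU.
have rff := regularM rf (regular_conj rf).
have rffU := regularM rfU (regular_conj rfU).
rewrite -(@Cintegral_unitary U (fun z => f z * Num.conj (f z))) //.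
by apply: eq_Cintegral => w _; rewrite -pE.
Qed.

(** * Configurations *)

Section Configuration.
Variable X : {fset V}.
Hypothesis hunit : forall x, x \in X -> sphere R d x.
Hypothesis hlines : distinct_lines X.
Local Notation B := (degree_set X `\ 0)%fset.

Lemma degree_setP (al : C) : reflect
  (exists x y, [/\ x \in X, y \in X, x != y & al = `|hdot x y| ^+ 2])
  (al \in degree_set X).
Proof.
apply: (iffP idP) => [/imfset2P /= [x xX [y yX ->]]|[x [y [xX yX xy ->]]]].
  by move: yX; rewrite !inE => /andP [yx yX]; exists x, y; split; rewrite // eq_sym.
by apply/imfset2P; exists x => //; exists y => //; rewrite !inE yX eq_sym xy.
Qed.

Lemma degree_lt1 al : al \in degree_set X -> 0 <= al < 1.
Proof.
move=> /degree_setP [x [y [xX yX xy ->]]]; rewrite exprn_ge0 //=.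
by apply: hdot_noncollinear; [exact: hunit|exact: hunit|exact: hlines].
Qed.

(* The annihilator polynomial of the degree set, centred at [x]; the factor for
   the degree [0] is [hdot x z] instead of its squared modulus. *)
Definition ann (x z : V) : C := hdot x z *
  \prod_(al <- B) (hdot x z * hdot z x - al * hdot z z).

Definition ann_diag : C := \prod_(al <- B) (1 - al).

(** Each nonzero degree costs one in both arguments and the degree [0] only one in the first, so [s]
    degrees including [0] give bidegree [(s, s - 1)]. *)
Lemma bihom_ann x : bihom #|` B|.+1 #|` B| (ann x).
Proof.
have fac (al : C) : bihom 1 1 (fun z => hdot x z * hdot z x - al * hdot z z).
  apply: bihomB; first exact: bihomM (bihom_hdotr x) (bihom_hdotl x).
  exact/bihomZ/bihom_normsq.
have := bihomM (bihom_hdotr x) (bihom_prod (enum_fset B) fac).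
by rewrite sum1_size add1n add0n.
Qed.

Lemma ann_diagE x : sphere R d x -> ann x x = ann_diag.
Proof.
rewrite /sphere /= => Sx; rewrite /ann Sx mul1r; apply: eq_bigr => al _.
by rewrite !mulr1.
Qed.

Lemma ann_off x y : x \in X -> y \in X -> x != y -> ann x y = 0.
Proof.
move=> xX yX xy; rewrite /ann; have [->|hn0] := eqVneq (hdot x y) 0.
  by rewrite mul0r.
have aB : `|hdot x y| ^+ 2 \in B.
  rewrite !inE expf_eq0 normr_eq0 hn0 /=; apply/degree_setP.
  by exists x, y.
rewrite (big_rem _ aB) /= hdot_sqr; have -> : hdot y y = 1 by exact: hunit.
by rewrite mulr1 subrr mul0r mulr0.
Qed.

Lemma ann_diag_neq0 : ann_diag != 0.
Proof.
rewrite prodf_seq_neq0; apply/allP => al /=; rewrite !inE => /andP [_ /degree_lt1].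
by move=> /andP [_ al1]; rewrite subr_eq0 gt_eqF.
Qed.

Lemma conj_ann_diag : Num.conj ann_diag = ann_diag.
Proof.
rewrite rmorph_prod; apply: eq_big_seq => al; rewrite !inE => /andP [_ /degree_lt1].
move=> /andP [al0 _]; rewrite rmorphB /= conjC1; congr (_ - _).
exact/CrealP/ger0_real.
Qed.

(** The degrees are real, so [ann] is a Hermitian kernel on the sphere. *)
Lemma conj_ann x z : sphere R d x -> sphere R d z -> Num.conj (ann x z) = ann z x.
Proof.
rewrite /sphere /= => Sx Sz; rewrite /ann rmorphM /= conj_hdot; congr (_ * _).
rewrite rmorph_prod; apply: eq_big_seq => al; rewrite !inE => /andP [_ /degree_lt1].
move=> /andP [al0 _]; rewrite rmorphB !rmorphM /= !conj_hdot Sx Sz !mulr1.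
by congr (_ - _); apply/CrealP/ger0_real.
Qed.

Lemma ann_unitary (U : 'M[C]_d) x z : U \is unitarymx ->
  ann (U *m x) (U *m z) = ann x z.
Proof.
move=> Uu; rewrite /ann hdot_unitary //; congr (_ * _); apply: eq_bigr => al _.
by rewrite !hdot_unitary.
Qed.

Lemma sum_ann (g : V -> C) y : y \in X ->
  \sum_(x <- X) g x * ann x y = g y * ann_diag.
Proof.
move=> yX; rewrite (bigD1_seq y) ?fset_uniq //= (ann_diagE (hunit yX)).
rewrite big_seq_cond big1 ?addr0 // => x /andP [xX xy].
by rewrite ann_off // mulr0.
Qed.

(** With [|X|] equal to the dimension, the matrix [E] of values of a basis on [X] is square:
    evaluation on [X] is onto exactly when it is injective. *)
Lemma interpolation k l : has_dim (homPoly R d k l) #|` X|%fset ->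
  (forall x, x \in X -> exists2 f, bihom k l f &
     forall y, y \in X -> f y = (y == x)%:R) <->
  (forall f, bihom k l f -> (forall y, y \in X -> f y = 0) -> forall z, f z = 0).
Proof.
move=> [e [eV eb]]; set n := #|` X|%fset in e eV eb *.
have [xs [xs_inj xsX xs_onto]] := fset_enumeration X 0.
pose E : 'M[C]_n := \matrix_(i, j) eval_conj (e i) (xs j).
have evE (c : 'rV[C]_n) z :
    eval_conj (\sum_i c 0 i *: e i) z = \sum_i c 0 i * eval_conj (e i) z.
  by rewrite /eval_conj raddf_sum; apply: eq_bigr => i _; rewrite /= mevalZ.
have evX (c : 'rV[C]_n) j : eval_conj (\sum_i c 0 i *: e i) (xs j) = (c *m E) 0 j.
  by rewrite evE mxE; apply: eq_bigr => i _; rewrite mxE.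
split=> [lag f [p pV pf] fX z|inj x xX].
  have [c [pc _]] := eb _ pV.
  have /choice [D DE] : forall i, exists D : 'rV[C]_n, D *m E = delta_mx 0 i.
    move=> i; have [g [q qV qg] gX] := lag _ (xsX i); have [D [qD _]] := eb _ qV.
    exists D; apply/rowP => j; rewrite -evX -qD qg gX // mxE eqxx /=.
    by rewrite (inj_eq xs_inj).
  pose D' : 'M[C]_n := \matrix_i D i.
  have DE1 : D' *m E = 1%:M.
    by apply/row_matrixP => i; rewrite row_mul rowK DE row1.
  have cE : c *m E = 0.
    by apply/rowP => j; rewrite -evX -pc pf fX // mxE.
  have c0 : c = 0 by rewrite -(mulmx1 c) -(mulmx1C DE1) mulmxA cE mul0mx.
  by rewrite -pf pc evE big1 // => i _; rewrite c0 mxE mul0r.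
have Eu : E \in unitmx.
  rewrite -row_free_unit -kermx_eq0; apply/eqP/row_matrixP => i; rewrite row0.
  set c := row i _; have cE : c *m E = 0 by apply/sub_kermxP/row_sub.
  have z0 : \sum_i c 0 i *: e i = 0.
    apply: eval_conj_inj; apply: inj => [|y /xs_onto [j ->]]; last first.
      by rewrite evX cE mxE.
    apply: (@eq_bihom _ _ _ _ (fun z => \sum_i c 0 i * eval_conj (e i) z)).
      by move=> z; rewrite evE.
    by apply: bihom_sum => j _; apply: bihomZ; exists (e j).
  have V0 : homPoly R d k l 0 by move=> m; rewrite msupp0.
  have [c' [_ uc]] := eb 0 V0.
  rewrite -(uc c) ?z0 // (uc 0) //; apply/esym/big1 => j _.
  by rewrite mxE scale0r.
have [i ->] := xs_onto _ xX.
exists (fun z => \sum_j row i (invmx E) 0 j * eval_conj (e j) z).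
  by apply: bihom_sum => j _; apply: bihomZ; exists (e j).
move=> y /xs_onto [j ->]; rewrite -evE evX -row_mul mulVmx // row1 mxE eqxx /=.
by rewrite (inj_eq xs_inj) eq_sym.
Qed.

(** * Distance sets that are designs: (a) and (b) give (c) *)

Lemma design_bihom t f : design omega t X -> bihom t t f ->
  (#|` X|%fset%:R)^-1 * (\sum_(z <- X) f z) = L f.
Proof. by move=> dX [p pV /funext <-]; exact: dX. Qed.

(** [f conj f] has bidegree [(2s - 1, 2s - 1)], so its integral is its average over [X], which is
    zero; [bihom_definite] concludes. *)
Lemma design_inj s f : (0 < s)%N -> design omega (2 * s - 1) X ->
  bihom s (s - 1) f -> (forall x, x \in X -> f x = 0) -> forall z, f z = 0.
Proof.
move=> s0 dX bf fX; apply: (bihom_definite bf).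
have bff := bihomM bf (bihom_conj bf).
have E1 : (s + (s - 1) = 2 * s - 1)%N by lia.
have E2 : (s - 1 + s = 2 * s - 1)%N by lia.
rewrite E1 E2 in bff; rewrite -(design_bihom dX bff) big_seq big1 ?mulr0 // => x xX.
by rewrite fX // mul0r.
Qed.

Lemma degree_set_cardE : 0 \in degree_set X ->
  #|` degree_set X|%fset = #|` B|%fset.+1.
Proof. by move=> h0; rewrite (cardfsD1 0) h0. Qed.

Lemma tight_of_design s : (0 < s)%N -> 0 \in degree_set X ->
  distance_set s X -> design omega (2 * s - 1) X ->
  has_dim (homPoly R d s (s - 1)) #|` X|%fset.
Proof.
move=> s0 h0 dist dX.
have sB : s = #|` B|%fset.+1 by rewrite -degree_set_cardE.
have annV x : bihom s (s - 1) (ann x).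
  by rewrite sB subn1; exact: bihom_ann.
set n := #|` X|%fset; have [xs [xs_inj xsX xs_onto]] := fset_enumeration X 0.
have /choice [e eP] : forall i, exists p, homPoly R d s (s - 1) p /\
    forall z, eval_conj p z = ann (xs i) z.
  by move=> i; have [p pV pE] := annV (xs i); exists p.
have evE (c : 'rV[C]_n) z :
    eval_conj (\sum_i c 0 i *: e i) z = \sum_i c 0 i * ann (xs i) z.
  rewrite /eval_conj raddf_sum; apply: eq_bigr => i _; rewrite /= mevalZ.
  by have [_ <-] := eP i.
have evX (c : 'rV[C]_n) j :
    eval_conj (\sum_i c 0 i *: e i) (xs j) = c 0 j * ann_diag.
  rewrite evE (bigD1 j) //= (ann_diagE (hunit (xsX j))) big1 ?addr0 // => i ij.
  by rewrite ann_off ?mulr0 // (inj_eq xs_inj).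
exists e; split=> [i|v vV]; first by have [] := eP i.
(* Evaluation at [xs i] forces the coordinate [v (xs i) / D]. With these coordinates the difference
   vanishes on [X], hence everywhere by [design_inj]. *)
exists (\row_i (eval_conj v (xs i) / ann_diag)); split=> [|c vc]; last first.
  apply/rowP => j; rewrite mxE vc evX mulfK //; exact: ann_diag_neq0.
apply/eqP; rewrite -subr_eq0; apply/eqP; apply: eval_conj_inj => z.
pose c : 'rV[C]_n := \row_i (eval_conj v (xs i) / ann_diag).
have bv : bihom s (s - 1) (eval_conj v) by exists v.
have bc : bihom s (s - 1) (fun z => \sum_i c 0 i * ann (xs i) z).
  by apply: bihom_sum => i _; apply: bihomZ.
rewrite /eval_conj mevalB -/(eval_conj v z) -/(eval_conj _ z) evE.
apply: (design_inj s0 dX (bihomB bv bc)) => x /xs_onto [j ->].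
by rewrite -evE evX mxE divfK ?subrr //; exact: ann_diag_neq0.
Qed.

(** Factors are moved one by one into [f1]. Applied to coordinates and to their conjugates, this
    cuts degree [2s - 1] into [s] and [s - 1]. *)
Lemma monomial_split (a : 'I_d -> nat) (g : 'I_d -> V -> C) k l p q :
  (forall j, bihom k l (g j)) -> (\sum_j a j = p + q)%N ->
  exists f1 f2, [/\ bihom (k * p) (l * p) f1, bihom (k * q) (l * q) f2 &
    forall z, \prod_j g j z ^+ a j = f1 z * f2 z].
Proof.
move=> bg; elim: p a => [|p IHp] a aE.
  exists (fun=> 1), (fun z => \prod_j g j z ^+ a j); split.
  - by rewrite !muln0; exact: bihom1.
  - have := bihom_prod (index_enum 'I_d) (fun j => bihomX (a j) (bg j)).
    by rewrite -!big_distrr /= aE.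
  by move=> z; rewrite mul1r.
have [j aj] : exists j, (0 < a j)%N.
  apply: contrapT => h; suff : (\sum_j a j = 0)%N by rewrite aE.
  apply: big1 => j _; apply/eqP; rewrite -leqn0 leqNgt; apply/negP => aj.
  by apply: h; exists j.
pose b i := (if i == j then (a i).-1 else a i).
have ab i : a i = (b i + (i == j))%N.
  by rewrite /b; case: eqP => [->|_]; rewrite ?addn1 ?prednK ?addn0.
have bE : (\sum_j b j = p + q)%N.
  have j1 : (\sum_i (i == j) = 1)%N.
    by rewrite (bigD1 j) //= eqxx big1 // => i /negPf ->.
  apply: (@addIn 1%N); rewrite -{1}j1 -big_split /= addn1 -addSn -aE.
  by apply: eq_bigr => i _; rewrite -ab.
have [f1 [f2 [b1 b2 fE]]] := IHp b bE.
exists (fun z => g j z * f1 z), f2; split=> // [|z].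
  by rewrite !mulnS; exact: bihomM.
rewrite -mulrA -fE; under eq_bigr do rewrite ab exprD.
rewrite big_split /= mulrC; congr (_ * _); rewrite (bigD1 j) //= eqxx expr1.
by rewrite big1 ?mulr1 // => i /negPf ->; rewrite expr0.
Qed.

(** The products [f conj g] span Hom(2s - 1, 2s - 1), since every monomial there is one of them. *)
Lemma design_products s : (0 < s)%N ->
  (forall f g, bihom s (s - 1) f -> bihom s (s - 1) g ->
    (#|` X|%fset%:R)^-1 * (\sum_(z <- X) f z * Num.conj (g z)) =
    L (fun z => f z * Num.conj (g z))) -> design omega (2 * s - 1) X.
Proof.
move=> s0 prod f0 f0V; have : bihom (2 * s - 1) (2 * s - 1) (eval_conj f0).
  by exists f0.
(* Regularity is carried through the induction because additivity of the integral needs it. *)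
suff main f : bihom (2 * s - 1) (2 * s - 1) f -> regular f /\
    (#|` X|%fset%:R)^-1 * (\sum_(z <- X) f z) = L f.
  by move=> /main [].
move: f; apply: (@bihom_ind _ _ (fun f => regular f /\
    (#|` X|%fset%:R)^-1 * (\sum_(z <- X) f z) = L f)).
- by move=> f g /funext ->.
- split; first exact: regular_cst.
  by rewrite big1 // mulr0 (@Cintegral_cst _ 0).
- move=> f g [rf Ef] [rg Eg]; split; first exact: regularD.
  by rewrite big_split /= mulrDr Ef Eg CintegralD.
move=> c a b aE bE.
have sE : (2 * s - 1 = s + (s - 1))%N by lia.
have [f1 [f2 [bf1 bf2 fE]]] : exists f1 f2, [/\ bihom s 0 f1, bihom (s - 1) 0 f2 &
    forall z : V, \prod_j z j 0 ^+ a j = f1 z * f2 z].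
  have := monomial_split (@bihom_coord R d) (etrans aE sE).
  by rewrite !mul1n !mul0n.
have [g1 [g2 [bg1 bg2 gE]]] : exists g1 g2, [/\ bihom 0 s g1, bihom 0 (s - 1) g2 &
    forall z : V, \prod_j Num.conj (z j 0) ^+ b j = g1 z * g2 z].
  have := monomial_split (@bihom_conj_coord R d) (etrans bE sE).
  by rewrite !mul1n !mul0n.
(* [F] joins [s] coordinates to [s - 1] conjugates; what is left has bidegree [(s - 1, s)], so its
   conjugate [G] lies in the same space as [F]. *)
pose F z := f1 z * g2 z; pose G z := Num.conj (f2 z * g1 z).
have bF : bihom s (s - 1) F by have := bihomM bf1 bg2; rewrite addn0 add0n.
have bG : bihom s (s - 1) G.
  by have := bihom_conj (bihomM bf2 bg1); rewrite addn0 add0n.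
have FG (z : V) : (\prod_j z j 0 ^+ a j) * (\prod_j Num.conj (z j 0) ^+ b j) =
    F z * Num.conj (G z).
  by rewrite fE gE /F /G conjCK; ring.
have rF := regularM (regular_bihom bF) (regular_conj (regular_bihom bG)).
under eq_fun do rewrite FG.
split; first exact: regularZ.
under eq_bigr do rewrite FG.
by rewrite CintegralZ // -mulr_sumr mulrCA prod.
Qed.

(** * The Gram matrix of the annihilators: (a) and (c) give (b) *)

Lemma design_of_tight s : (0 < s)%N -> 0 \in degree_set X ->
  distance_set s X -> has_dim (homPoly R d s (s - 1)) #|` X|%fset ->
  design omega (2 * s - 1) X.
Proof.
move=> s0 h0 dist hd; set n := #|` X|%fset.
have sB : s = #|` B|%fset.+1 by rewrite -degree_set_cardE.
have annV x : bihom s (s - 1) (ann x).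
  by rewrite sB subn1; exact: bihom_ann.
have D0 := ann_diag_neq0; have cD := conj_ann_diag.
(* The functions [F_x / D] are Lagrange functions for [X], so the square evaluation matrix is
   invertible. *)
have inj : forall f, bihom s (s - 1) f -> (forall y, y \in X -> f y = 0) ->
    forall z, f z = 0.
  apply/(interpolation hd) => x xX.
  exists (fun z => ann_diag^-1 * ann x z); first exact: bihomZ.
  move=> y yX; have [->|yx] := eqVneq y x.
    by rewrite (ann_diagE (hunit xX)) mulVf.
  by rewrite ann_off ?mulr0 // eq_sym.
have expand f z : bihom s (s - 1) f ->
    ann_diag * f z = \sum_(x <- X) f x * ann x z.
  move=> bf; apply/eqP; rewrite -subr_eq0; apply/eqP; move: z.
  apply: (inj (fun z => ann_diag * f z - \sum_(x <- X) f x * ann x z)).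
    apply: bihomB; first exact: bihomZ.
    by apply: bihom_sum => x _; exact: bihomZ.
  by move=> y yX; rewrite sum_ann // mulrC subrr.
have rann x := regular_bihom (annV x).
pose Gam x y := L (fun z => ann x z * Num.conj (ann y z)).
have rG x y : regular (fun z => ann x z * Num.conj (ann y z)).
  exact: regularM (rann x) (regular_conj (rann y)).
have [x0 x0X] : exists x0, x0 \in X.
  by have [x [y [xX _ _ _]]] := degree_setP _ h0; exists x.
pose gam := Gam x0 x0.
have GamE z : sphere R d z -> Gam z z = gam.
  move=> Sz; have [U Uu <-] := sphere_transitive (hunit x0X) Sz.
  rewrite /Gam -(Cintegral_unitary Uu (rG _ _)).
    by apply: eq_Cintegral => v _; rewrite ann_unitary.
  have := regular_bihom (bihom_mulmx U (annV (U *m x0))) => r.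
  exact: regularM r (regular_conj r).
have expandS z w : sphere R d z ->
    ann_diag * ann z w = \sum_(x <- X) Num.conj (ann x z) * ann x w.
  move=> Sz; rewrite expand //; apply: eq_big_seq => x xX.
  by rewrite -conj_ann // ; exact: hunit.
(* On the sphere, the expansion of [D F_z] taken at [z] itself reads [D^2 = \sum_x |F_x z|^2];
   integrate over [z]. *)
have D2 : ann_diag ^+ 2 = n%:R * gam.
  have -> : ann_diag ^+ 2 = L (fun z => \sum_(x <- X) ann x z * Num.conj (ann x z)).
    symmetry; apply: Cintegral_cst => z Sz.
    rewrite expr2 -{2}(ann_diagE Sz) expandS //.
    by apply: eq_bigr => x _; rewrite mulrC.
  rewrite Cintegral_sum // (eq_big_seq (fun=> gam)) => [|x xX].
    by rewrite big_const_seq count_predT iter_addr_0 mulr_natl.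
  exact: GamE (hunit xX).
have cgam : Num.conj gam = gam.
  apply/CrealP/ger0_real/Cintegral_ge0 => z _.
  by rewrite -normCK exprn_ge0.
have GamC x y : L (fun z => Num.conj (ann x z) * ann y z) = Num.conj (Gam x y).
  rewrite -Cintegral_conj //; apply: eq_Cintegral => z _.
  by rewrite [RHS]rmorphM /= conjCK.
(* Two integrations: for fixed [z], the mean square of [D F_z] is [D^2 gam], and its expansion
   contains [Gam x y]; integrating the coefficients over [z] then supplies the factor
   [conj (Gam x y)]. *)
have GG : \sum_(x <- X) \sum_(y <- X) `|Gam x y| ^+ 2 = ann_diag ^+ 2 * gam.
  have D2E z : sphere R d z -> \sum_(x <- X) \sum_(y <- X)
      (Num.conj (ann x z) * ann y z) * Gam x y = ann_diag ^+ 2 * gam.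
    move=> Sz; rewrite -(GamE z Sz) /Gam -CintegralZ //.
    transitivity (L (fun v => \sum_(x <- X) \sum_(y <- X)
        (Num.conj (ann x z) * ann y z) * (ann x v * Num.conj (ann y v)))).
      rewrite Cintegral_sum => [|x]; last by apply: regular_sum => y; exact: regularZ.
      apply: eq_bigr => x _; rewrite Cintegral_sum => [|y]; last exact: regularZ.
      by apply: eq_bigr => y _; rewrite CintegralZ.
    apply: eq_Cintegral => v _.
    transitivity ((ann_diag * ann z v) * Num.conj (ann_diag * ann z v)).
      rewrite expandS // rmorph_sum mulr_suml; apply: eq_bigr => x _.
      rewrite mulr_sumr; apply: eq_bigr => y _.
      by rewrite rmorphM /= conjCK; ring.
    by rewrite rmorphM /= cD; ring.
  have rr x y : regular (fun z => Num.conj (ann x z) * ann y z * Gam x y).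
    by apply: regularM (regular_cst _); apply: regularM (rann y); apply: regular_conj.
  rewrite -(@Cintegral_cst (fun z => \sum_(x <- X) \sum_(y <- X)
      (Num.conj (ann x z) * ann y z) * Gam x y) (ann_diag ^+ 2 * gam)) //.
  rewrite Cintegral_sum => [|x]; last exact: regular_sum.
  apply: eq_bigr => x _; rewrite Cintegral_sum //; apply: eq_bigr => y _.
  rewrite (@eq_Cintegral _ (fun z => Gam x y * (Num.conj (ann x z) * ann y z))).
    rewrite CintegralZ ?GamC -?normCK //.
    by apply: regularM (rann y); apply: regular_conj.
  by move=> z _; rewrite mulrC.
(* The diagonal terms alone sum to [n gam^2 = D^2 gam], the full sum in [GG], so the nonnegative
   off-diagonal terms all vanish. *)
have Goff x y : x \in X -> y \in X -> x != y -> Gam x y = 0.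
  have : \sum_(x <- X) \sum_(y <- X | y != x) `|Gam x y| ^+ 2 = 0.
    apply: (addrI (\sum_(x <- X) `|Gam x x| ^+ 2)); rewrite -big_split addr0 /=.
    rewrite [in RHS](eq_big_seq (fun=> gam * gam)) => [|u uX]; last first.
      by rewrite normCK (GamE _ (hunit uX)) cgam.
    rewrite big_const_seq count_predT iter_addr_0 -mulr_natl mulrA -D2 -GG.
    by apply: eq_big_seq => u uX; rewrite [RHS](bigD1_seq u) ?fset_uniq.
  move=> /eqP; rewrite psumr_eq0 => [|u _]; last first.
    by apply: sumr_ge0 => v _; rewrite exprn_ge0.
  move=> /allP h xX yX xy; have /eqP := h x xX.
  move=> /eqP; rewrite psumr_eq0 => [|v _]; last by rewrite exprn_ge0.
  by move=> /allP /(_ y yX); rewrite eq_sym xy expf_eq0 normr_eq0 => /eqP.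
have n0 : n%:R != 0 :> C.
  by rewrite pnatr_eq0 -lt0n cardfs_gt0; apply/fset0Pn; exists x0.
(* This value of the diagonal entries is what turns the Gram form into the average over [X], after
   cancelling [D^2]. *)
have gamE : gam = ann_diag ^+ 2 / n%:R by rewrite D2 mulrAC divff // mul1r.
apply: design_products => // f g bf bg.
have D20 : ann_diag ^+ 2 != 0 by rewrite expf_eq0.
apply: (mulfI D20).
have -> : ann_diag ^+ 2 * L (fun z => f z * Num.conj (g z)) =
    \sum_(x <- X) \sum_(y <- X) (f x * Num.conj (g y)) * Gam x y.
  have rfg := regularM (regular_bihom bf) (regular_conj (regular_bihom bg)).
  rewrite -CintegralZ //.
  transitivity (L (fun z => \sum_(x <- X) \sum_(y <- X)
        (f x * Num.conj (g y)) * (ann x z * Num.conj (ann y z)))).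
    apply: eq_Cintegral => z _.
    transitivity ((ann_diag * f z) * Num.conj (ann_diag * g z)).
      by rewrite rmorphM /= cD; ring.
    rewrite !expand // rmorph_sum mulr_suml; apply: eq_bigr => x _.
    rewrite mulr_sumr; apply: eq_bigr => y _.
    by rewrite rmorphM /=; ring.
  rewrite Cintegral_sum => [|x]; last by apply: regular_sum => y; exact: regularZ.
  apply: eq_bigr => x _; rewrite Cintegral_sum => [|y]; last exact: regularZ.
  by apply: eq_bigr => y _; rewrite CintegralZ.
rewrite mulrA -gamE mulr_sumr; apply: eq_big_seq => x xX.
rewrite (bigD1_seq x) ?fset_uniq //= (GamE _ (hunit xX)).
rewrite big_seq_cond big1 ?addr0 1?mulrC // => y /andP [yX yx].
by rewrite Goff ?mulr0 // eq_sym.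
Qed.

(** * Polynomials on the unit circle and rotational averages *)

Lemma poly_unit_circle_eq0 (p : {poly C}) :
  (forall u, u * Num.conj u = 1 -> p.[u] = 0) -> p = 0.
Proof.
move=> pu; apply/eqP; apply: contraT => p0.
have prod0 (r : nat) : (1 + 'i * r%:R) * (1 - 'i * r%:R) != 0 :> C.
  have -> : (1 + 'i * r%:R) * (1 - 'i * r%:R) = 1 - 'i ^+ 2 * r%:R ^+ 2 :> C by ring.
  by rewrite sqrCi mulN1r opprK gt_eqF // ltr_wpDr // exprn_ge0.
have num0 (r : nat) : 1 + 'i * r%:R != 0 :> C.
  by move: (prod0 r); rewrite mulf_eq0 negb_or => /andP [].
have den0 (r : nat) : 1 - 'i * r%:R != 0 :> C.
  by move: (prod0 r); rewrite mulf_eq0 negb_or => /andP [].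
(* Cayley transforms of natural numbers: distinct points of the unit circle, as many as needed to
   exceed the possible number of roots. *)
pose u (r : nat) : C := (1 + 'i * r%:R) / (1 - 'i * r%:R).
have := @max_poly_roots _ p [seq u r | r <- iota 0 (size p)] p0.
rewrite size_map size_iota ltnn; apply.
  apply/allP => _ /mapP [r _ ->]; apply/eqP; apply: pu.
  rewrite /u rmorphM fmorphV rmorphB rmorphD rmorphM /= conjC1 conjCi conjC_nat.
  by rewrite mulNr opprK; field; rewrite den0 num0.
rewrite map_inj_uniq ?iota_uniq // => r r'.
have i0 : 'i != 0 :> C by exact: neq0Ci.
rewrite /u => /eqP; rewrite eqr_div // => /eqP E.
have : 2%:R * 'i * (r%:R - r'%:R) = 0 :> C.
  transitivity ((1 + 'i * r%:R) * (1 - 'i * r'%:R) -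
    (1 + 'i * r'%:R) * (1 - 'i * r%:R) : C); last by rewrite E subrr.
  by ring.
move/eqP; rewrite !mulf_eq0 pnatr_eq0 (negPf i0) subr_eq0 eqr_nat /=.
by move/eqP.
Qed.

Lemma size_prod_lin (a : 'I_d -> nat) (p : 'I_d -> {poly C}) :
  (forall j, size (p j) <= 2)%N ->
  (size (\prod_j p j ^+ a j)%R <= (\sum_j a j).+1)%N.
Proof.
move=> sp; apply: leq_trans (size_prod_leq _ _) _.
rewrite leq_subLR; apply: (@leq_trans (\sum_j (a j).+1).+1); last first.
  by rewrite addnS ltnS; under eq_bigr do rewrite -addn1;
    rewrite big_split /= sum_nat_const muln1 addnC.
rewrite ltnS; apply: leq_sum => j _; apply: leq_trans (size_exp_leq _ _) _.
by rewrite ltnS -[X in (_ <= X)%N]mul1n leq_mul2r -ltnS; apply/orP; right;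
  have := sp j; case: (size (p j)) => [|m].
Qed.

(* Along a circle [x + rho u w], [|u| = 1], the function [u ^ l * f] is a
   polynomial in [u] whose coefficient of index [l], the rotational average, is
   a polynomial in [rho ^ 2]. *)
Lemma rotation_average k l f x w : bihom k l f -> exists Q : {poly C},
  [/\ (size Q <= l.+1)%N, Q.[0] = f x & forall rho : C, Num.conj rho = rho ->
    (forall u, u * Num.conj u = 1 -> f (x + (rho * u) *: w) = 0) ->
    Q.[rho ^+ 2] = 0].
Proof.
move=> bf.
suff [Q [T [sQ Q0 TQ]]] : exists (Q : {poly C}) (T : C -> {poly C}),
    [/\ (size Q <= l.+1)%N, Q.[0] = f x &
     forall rho : C, Num.conj rho = rho -> (T rho)`_l = Q.[rho ^+ 2] /\
       forall u, u * Num.conj u = 1 ->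
         f (x + (rho * u) *: w) * u ^+ l = (T rho).[u]].
  exists Q; split=> // rho rr fu; have [<- Tu] := TQ rho rr.
  rewrite (@poly_unit_circle_eq0 (T rho)) ?coef0 // => u uu.
  by rewrite -Tu // fu ?mul0r.
apply: (@bihom_ind _ _ (fun f => exists (Q : {poly C}) (T : C -> {poly C}),
    [/\ (size Q <= l.+1)%N, Q.[0] = f x &
     forall rho : C, Num.conj rho = rho -> (T rho)`_l = Q.[rho ^+ 2] /\
       forall u, u * Num.conj u = 1 ->
         f (x + (rho * u) *: w) * u ^+ l = (T rho).[u]])) bf.
- by move=> f1 f2 /funext ->.
- exists 0, (fun=> 0); split; rewrite ?size_poly0 ?horner0 // => rho _.
  by rewrite coef0 horner0; split=> // u _; rewrite mul0r horner0.
- move=> f1 f2 [Q1 [T1 [s1 e1 h1]]] [Q2 [T2 [s2 e2 h2]]].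
  exists (Q1 + Q2), (fun rho => T1 rho + T2 rho); split.
  + by rewrite (leq_trans (size_polyD _ _)) // geq_max s1 s2.
  + by rewrite hornerD e1 e2.
  move=> rho rr; have [c1 g1] := h1 rho rr; have [c2 g2] := h2 rho rr.
  rewrite coefD hornerD c1 c2; split=> // u uu.
  by rewrite hornerD mulrDl g1 ?g2.
move=> c a b aE bE.
(* The two factors of the monomial along [x + t w], as polynomials in [t] and in [conj t]. *)
pose A : {poly C} := \prod_j ((x j 0)%:P + w j 0 *: 'X) ^+ a j.
pose B' : {poly C} :=
  \prod_j ((Num.conj (x j 0))%:P + Num.conj (w j 0) *: 'X) ^+ b j.
have sB : (size B' <= l.+1)%N.
  rewrite -bE; apply: size_prod_lin => j.
  apply: leq_trans (size_polyD _ _) _; rewrite geq_max size_polyC.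
  by rewrite (leq_trans (size_scale_leq _ _)) ?size_polyX ?andbT //; case: eqP.
(* On the circle [conj u ^ i * u ^ l = u ^ (l - i)], so multiplying by [u ^ l] reverses the
   coefficients of [B']. The coefficient of index [l] then pairs [A_i] with [B'_i], with weight
   [rho ^ (2 i)]. *)
exists (c *: \poly_(i < l.+1) (A`_i * B'`_i)), (fun rho =>
  c *: ((\poly_(i < size A) (A`_i * rho ^+ i)) *
        (\poly_(i < l.+1) (B'`_(l - i) * rho ^+ (l - i))))).
have AE t : A.[t] = \prod_j (x j 0 + t * w j 0) ^+ a j.
  rewrite horner_prod; apply: eq_bigr => j _.
  by rewrite horner_exp hornerD hornerC hornerZ hornerX mulrC.
have BE t : B'.[t] = \prod_j (Num.conj (x j 0) + t * Num.conj (w j 0)) ^+ b j.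
  rewrite horner_prod; apply: eq_bigr => j _.
  by rewrite horner_exp hornerD hornerC hornerZ hornerX mulrC.
split.
- by rewrite (leq_trans (size_scale_leq _ _)) ?size_poly.
- rewrite hornerZ horner_coef0 coef_poly /= -!horner_coef0 AE BE.
  by congr (_ * (_ * _)); apply: eq_bigr => j _; rewrite mul0r addr0.
move=> rho rr; split.
  rewrite coefZ hornerZ; congr (_ * _); rewrite coefM horner_poly.
  apply: eq_bigr => i _; have il : (i <= l)%N by rewrite -ltnS.
  rewrite !coef_poly ltnS leq_subr subKn //.
  case: ltnP => [_|/(nth_default 0) ->]; last by rewrite !mul0r.
  by rewrite -exprM mul2n -addnn exprD; ring.
move=> u uu; rewrite hornerZ hornerM -!mulrA; congr (_ * _); rewrite mulrA.
have -> : (\poly_(i < size A) (A`_i * rho ^+ i)).[u] = A.[rho * u].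
  rewrite horner_poly horner_coef; apply: eq_bigr => i _.
  by rewrite exprMn mulrA.
have -> : (\poly_(i < l.+1) (B'`_(l - i) * rho ^+ (l - i))).[u] =
    B'.[rho * Num.conj u] * u ^+ l.
  rewrite horner_poly (horner_coef_wide _ sB) mulr_suml.
  rewrite (reindex_inj rev_ord_inj) /=; apply: eq_bigr => i _.
  have il : (i <= l)%N by rewrite -ltnS.
  rewrite subSS subKn // exprMn -!mulrA; congr (_ * (_ * _)).
  have -> : u ^+ l = u ^+ (l - i) * u ^+ i by rewrite -exprD subnK.
  rewrite mulrCA.
  by rewrite -exprMn [Num.conj u * u]mulrC uu expr1n mulr1.
rewrite AE BE -mulrA; congr (_ * (_ * _)); apply: eq_bigr => j _.
  by rewrite !mxE.
by rewrite !mxE rmorphD !rmorphM /= rr.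
Qed.

(* With fewer than [s] degrees, [F_x] has room for the extra factor [|y^* z|^2],
   where [y] in [X] is orthogonal to [x]. *)
Lemma card_degree_ge s : (0 < s)%N -> 0 \in degree_set X ->
  design omega (2 * s - 1) X -> (s <= #|` degree_set X|%fset)%N.
Proof.
move=> s0 h0 dX; rewrite leqNgt; apply/negP; rewrite degree_set_cardE // => Bs.
have [x [y [xX yX xy hxy]]] := degree_setP _ h0.
have {}hxy : hdot x y = 0.
  by apply/eqP; rewrite -normr_eq0 -sqrf_eq0 -hxy.
(* [e] counts the factors [|z|^2] that pad the product up to bidegree [(s, s - 1)]. *)
pose b := #|` B|%fset; pose e := (s - b.+2)%N.
have [bV1 bV2] : (b.+1 + e + 1 = s)%N /\ (b + e + 1 = s - 1)%N.
  by rewrite /e /b; split; lia.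
have b1 := bihomM (bihom_ann x) (bihomX e (bihom_normsq R d)).
have b2 := bihomM (bihom_hdotr y) (bihom_hdotl y).
have := bihomM b1 b2; rewrite !mul1n addn0 add0n -/b bV1 bV2 => bf.
(* The first factor is nonzero at [x] and the second at [y], so the product is a nonzero function;
   yet it vanishes on [X], at [x] through [hdot y x = 0] and elsewhere through [ann_off]. *)
have [z /negP] : exists z, ann x z * hdot z z ^+ e * (hdot y z * hdot z y) != 0.
  apply: (bihom_mul_neq0 b1 b2); [exists x|exists y].
    rewrite (ann_diagE (hunit xX)) (_ : hdot x x = 1) ?expr1n ?mulr1 //.
      exact: ann_diag_neq0.
    exact: hunit xX.
  by rewrite (_ : hdot y y = 1) ?mulr1 ?oner_eq0 //; exact: hunit yX.
apply; apply/eqP; apply: (design_inj s0 dX bf) => {}z zX.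
have [->|zx] := eqVneq z x; first by rewrite hxy !mulr0.
by rewrite ann_off ?mul0r // eq_sym.
Qed.

(** * Equivariant Lagrange functions and the upper bound on the number of degrees *)

Lemma card_degree_le s : (0 < s)%N -> 0 \in degree_set X ->
  design omega (2 * s - 1) X -> has_dim (homPoly R d s (s - 1)) #|` X|%fset ->
  (#|` degree_set X|%fset <= s)%N.
Proof.
move=> s0 h0 dX hd; rewrite degree_set_cardE //.
have inj f : bihom s (s - 1) f -> (forall x, x \in X -> f x = 0) ->
  forall z, f z = 0 by exact: design_inj.
(* Membership in [X] is put inside the existential, with the function 0 as default, so that [choice]
   applies to all vectors. *)
have lag x : exists f : V -> C, x \in X -> bihom s (s - 1) f /\
    forall y, y \in X -> f y = (y == x)%:R.
  have [xX|_] := boolP (x \in X); last by exists (fun=> 0).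
  by have [f bf fX] := (interpolation hd).2 inj x xX; exists f.
have [l lP] := choice lag.
have lV x : x \in X -> bihom s (s - 1) (l x) by move=> /lP [].
have lX x y : x \in X -> y \in X -> l x y = (y == x)%:R by move=> /lP [_]; exact.
pose n : C := (#|` X|%fset%:R)^-1.
(* The design sums [f conj (l x)] over [X], where only the term at [x] survives; [n] is
   [1 / |X|]. *)
have repr x f : x \in X -> bihom s (s - 1) f ->
    L (fun z => f z * Num.conj (l x z)) = n * f x.
  move=> xX bf; have := bihomM bf (bihom_conj (lV x xX)).
  have [-> ->] : (s + (s - 1) = 2 * s - 1 /\ s - 1 + s = 2 * s - 1)%N by lia.
  move=> /(design_bihom dX) <-; congr (_ * _).
  rewrite (bigD1_seq x) ?fset_uniq //= lX // eqxx conjC1 mulr1.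
  rewrite big_seq_cond big1 ?addr0 // => y /andP [yX /negPf yx].
  by rewrite lX // yx conjC0 mulr0.
(* The difference [g] has product [n g(x)] with [l x] by reproduction, and the same product with
   [l x0] composed with [U] by invariance, so its mean square is zero. *)
have lU x x0 (U : 'M[C]_d) z : x \in X -> x0 \in X -> U \is unitarymx ->
    U *m x = x0 -> l x z = l x0 (U *m z).
  move=> xX x0X Uu Ux; pose g z := l x z - l x0 (U *m z).
  have blU := bihom_mulmx U (lV x0 x0X).
  have bg : bihom s (s - 1) g by exact: bihomB (lV x xX) blU.
  suff g0 : forall z, g z = 0 by apply/eqP; rewrite -subr_eq0; apply/eqP/g0.
  apply: (bihom_definite bg).
  have gl : L (fun z => g z * Num.conj (l x z)) = n * g x by exact: repr.
  have UK v : (U^t*)%sesqui *m (U *m v) = v.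
    by rewrite mulmxA (mulmx1C (unitarymxP Uu)) mul1mx.
  have glU : L (fun z => g z * Num.conj (l x0 (U *m z))) = n * g x.
    pose g' w := g ((U^t*)%sesqui *m w).
    have bg' : bihom s (s - 1) g' by exact: bihom_mulmx.
    have rg' := regularM (regular_bihom bg')
      (regular_conj (regular_bihom (lV x0 x0X))).
    have rgU := regularM (regular_bihom bg) (regular_conj (regular_bihom blU)).
    rewrite (@eq_Cintegral _
      (fun z => (fun w => g' w * Num.conj (l x0 w)) (U *m z))); last first.
      by move=> w _; rewrite /g' UK.
    rewrite (Cintegral_unitary Uu rg'); last first.
      by apply: eq_regular rgU => w; rewrite /g' UK.
    by rewrite (repr x0) // /g' -Ux UK.
  have rgl := regularM (regular_bihom bg) (regular_conj (regular_bihom (lV x xX))).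
  have rglU := regularM (regular_bihom bg) (regular_conj (regular_bihom blU)).
  rewrite (@eq_Cintegral _ (fun z => g z * Num.conj (l x z) +
    (-1) * (g z * Num.conj (l x0 (U *m z))))); last first.
    by move=> w _; rewrite {2}/g rmorphB /=; ring.
  rewrite (CintegralD rgl (regularZ _ rglU)) (CintegralZ _ rglU) gl glU.
  by rewrite mulN1r subrr.
have [x0 [w0 [x0X w0X xw hxw]]] := degree_setP _ h0.
have {}hxw : hdot x0 w0 = 0.
  by apply/eqP; rewrite -normr_eq0 -sqrf_eq0 -hxw.
have hwx : hdot w0 x0 = 0 by rewrite -conj_hdot hxw conjC0.
have [Q [sQ Q0 QT]] := rotation_average x0 w0 (lV x0 x0X).
have Qn0 : Q != 0.
  apply: contraTneq isT => Qz; have := Q0; rewrite Qz horner0 lX // eqxx => /esym/eqP.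
  by rewrite oner_eq0.
(* For a pair [x], [y] of degree [t], the vectors [a (x0 + rho u w0)] with [rho^2 = 1/t - 1] are
   unit and have product [a] with [x0]. A unitary map carries [(x, y)] to [x0] and any of them, so
   [l x0] vanishes on the whole circle. *)
have rootQ t : t \in B -> root Q (t^-1 - 1).
  rewrite !inE => /andP [tn0 tD]; have /andP [t0 t1] := degree_lt1 tD.
  have tpos : 0 < t by rewrite lt_neqAle eq_sym tn0.
  have [x [y [xX yX xy tE]]] := degree_setP _ tD.
  have an0 : hdot x y != 0.
    by apply: contra_neq tn0 => a0; rewrite tE a0 normr0 expr0n.
  have aa : hdot x y * Num.conj (hdot x y) = t by rewrite tE normCK.
  set a := hdot x y in an0 aa.
  have r0 : 0 <= t^-1 - 1 by rewrite subr_ge0 invf_ge1 // ltW.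
  have rr : Num.conj (sqrtC (t^-1 - 1)) = sqrtC (t^-1 - 1).
    by apply/CrealP/ger0_real; rewrite sqrtC_ge0.
  rewrite /root -(sqrtCK (t^-1 - 1)); apply/eqP; apply: (QT _ rr) => u uu.
  set rho := sqrtC (t^-1 - 1) in rr *.
  have rho2 : rho * rho = t^-1 - 1 by rewrite -expr2 sqrtCK.
  pose y' := a *: (x0 + (rho * u) *: w0).
  have Sy' : sphere R d y'.
    rewrite /sphere /= /y' hdotZl hdotZr !hdotDl !hdotDr !hdotZl !hdotZr.
    rewrite hxw hwx; have -> : hdot x0 x0 = 1 by exact: hunit x0X.
    have -> : hdot w0 w0 = 1 by exact: hunit w0X.
    rewrite rmorphM /= rr.
    transitivity ((a * Num.conj a) * (1 + (rho * rho) * (u * Num.conj u))).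
      by ring.
    by rewrite aa uu rho2 mulr1 addrC subrK mulfV.
  have axy : hdot x y = hdot x0 y'.
    rewrite /y' hdotZr hdotDr hdotZr hxw mulr0 addr0.
    by have -> : hdot x0 x0 = 1 by [exact: hunit x0X]; rewrite mulr1.
  have [U Uu [Ux Uy]] :=
    unitary_move2 (hunit xX) (hunit yX) (hunit x0X) Sy' axy.
  have : l x0 y' = 0.
    by rewrite -Uy -(lU x x0 U y) // lX // eq_sym (negPf xy).
  rewrite /y' (bihom_scale _ _ (lV x0 x0X)) => /eqP.
  by rewrite !mulf_eq0 !expf_eq0 conjC_eq0 (negPf an0) !andbF => /eqP.
(* [Q] is nonzero of size at most [s] and [1/t - 1] determines [t], so there are fewer than [s]
   nonzero degrees; the degree [0] makes up the last one. *)
have := @max_poly_roots _ Q [seq t^-1 - 1 | t <- enum_fset B] Qn0.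
rewrite size_map => h; apply: leq_trans (h _ _) _.
- by apply/allP => _ /mapP [t tB ->]; exact: rootQ.
- by rewrite map_inj_uniq ?fset_uniq // => t t' /addIr/invr_inj.
by rewrite (leq_trans sQ) // subn1 prednK.
Qed.
End Configuration.
End SphereIntegral.

Theorem corollary3p5p17 (R : realType) (d : nat)
  (omega : probability (borelC R d) R) (homega : invariant_on_sphere omega)
  (s : nat) (hs : (1 <= s)%N)
  (X : {fset 'cV[R[i]%C]_d})
  (hunit : forall x, x \in X -> sphere R d x)
  (hlines : distinct_lines X)
  (h0 : 0%R \in degree_set X) :
  [/\ (distance_set s X /\ design omega (2 * s - 1) X ->
         has_dim (homPoly R d s (s - 1)) #|` X|%fset),
      (distance_set s X /\ has_dim (homPoly R d s (s - 1)) #|` X|%fset ->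
         design omega (2 * s - 1) X)
    & (design omega (2 * s - 1) X /\
         has_dim (homPoly R d s (s - 1)) #|` X|%fset ->
         distance_set s X)].
Proof.
split=> [[]|[]|[dX hd]].
- exact: tight_of_design.
- exact: design_of_tight.
apply/eqP; rewrite eqn_leq (card_degree_le homega hunit hlines hs h0 dX hd).
exact: (card_degree_ge homega hunit hlines hs h0 dX).
Qed.
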